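(* For every graph $G$ that is a subgraph of a (finite) square grid graph or of a (finite) hexagonal grid graph, there exists a touching triangles representation of $G$, and such a representation can be computed in time linear in the size of $G$.
   Context: A square grid graph is a finite subgraph of the infinite square lattice (vertices at integer points, edges between points at distance 1); a hexagonal grid graph is a finite subgraph of the infinite hexagonal (honeycomb) lattice. A touching triangles representation of a graph $G=(V,E)$ is a set $R$ of triangles in the plane with pairwise disjoint interiors, together with a bijection between $V$ and $R$, such that two triangles touch non-trivially (i.e., their boundaries share a line segment of positive length; sharing only a point does not count) if and only if the corresponding vertices are adjacent in $G$. *)

(* Defs.v *)
(* MathComp and MathComp-Analysis. *)
From HB Require Import structures.
From mathcomp Require Export all_boot all_order all_algebra.
From mathcomp Require Export boolp classical_sets reals topology normedtype.

Set Implicit Arguments.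
Unset Strict Implicit.
Unset Printing Implicit Defensive.

Export Order.TTheory GRing.Theory Num.Theory.
Export numFieldNormedType.Exports.
#[export] Set Warnings "-notation-overridden".

Local Open Scope classical_set_scope.
Local Open Scope ring_scope.

(** * Grid graphs *)

Definition simple_graph (T : finType) (e : rel T) : Prop :=
  symmetric e /\ irreflexive e.

Inductive grid_kind := Square | Hexagonal.

(* The vertex [(i, j, s)] of the honeycomb lattice stands for the point
   [i a + j b + s (a + b) / 3], where [a] and [b] have length [sqrt 3] and form
   an angle of 60 degrees: two vertices per fundamental cell, and edges of
   length 1. *)
Definition lattice_point (k : grid_kind) : Type :=
  match k with
  | Square => int * int
  | Hexagonal => int * int * bool
  end.

Definition square_adj (p q : int * int) : bool :=
  (p.1 - q.1) ^+ 2 + (p.2 - q.2) ^+ 2 == 1.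

(* The difference between the cell of an [s = 1] vertex and the cell of an
   adjacent [s = 0] vertex. *)
Definition hex_offsets : seq (int * int) := [:: (0, 0); (-1, 0); (0, -1)].

Definition hex_adj (p q : int * int * bool) : bool :=
  let: (i, j, s) := p in
  let: (i', j', s') := q in
  match s, s' with
  | false, true => (i' - i, j' - j) \in hex_offsets
  | true, false => (i - i', j - j') \in hex_offsets
  | _, _ => false
  end.

Definition lattice_adj (k : grid_kind) : rel (lattice_point k) :=
  match k with
  | Square => square_adj
  | Hexagonal => hex_adj
  end.

(* [f] identifies the graph [e] with a (not necessarily induced) subgraph
   of [g]. *)
Definition subgraph_map (T U : Type) (e : rel T) (g : rel U) (f : T -> U) :
  Prop := injective f /\ forall x y, e x y -> g (f x) (f y).

Definition subgraph (T U : Type) (e : rel T) (g : rel U) : Prop :=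
  exists f : T -> U, subgraph_map e g f.

Definition grid_graph (k : grid_kind) (U : finType) (g : rel U) : Prop :=
  simple_graph g /\ subgraph g (@lattice_adj k).

(** * Touching triangles representations *)

(* A triangle with vertex coordinates in [A]. *)
Record triangle (A : Type) := Triangle {
  corner1 : A * A;
  corner2 : A * A;
  corner3 : A * A
}.

Section Plane.
Variable R : realType.

Definition nondegenerate (t : triangle R) : Prop :=
  let: Triangle p q r := t in
  (q.1 - p.1) * (r.2 - p.2) - (q.2 - p.2) * (r.1 - p.1) != 0.

Definition triangle_set (t : triangle R) : set (R * R) :=
  let: Triangle p q r := t in
  [set x | exists a b c : R, [/\ 0 <= a, 0 <= b, 0 <= c, a + b + c = 1 &
     x = a *: p + b *: q + c *: r]].

Definition segment_set (p q : R * R) : set (R * R) :=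
  [set x | exists2 a : R, 0 <= a <= 1 & x = (1 - a) *: p + a *: q].

Definition boundary (A : set (R * R)) : set (R * R) :=
  closure A `\` interior A.

Definition touch (A B : set (R * R)) : Prop :=
  exists p q : R * R, p <> q /\ segment_set p q `<=` boundary A `&` boundary B.

(* The set of triangles is given by its bijective indexing [t] by the vertices;
   disjointness of the interiors of nondegenerate triangles makes [t]
   injective. *)
Definition touching_triangles (T : finType) (e : rel T) (t : T -> triangle R) :
  Prop :=
  [/\ forall x, nondegenerate (t x),
      forall x y, x != y ->
        interior (triangle_set (t x)) `&` interior (triangle_set (t y)) = set0
    & forall x y, x != y ->
        (touch (triangle_set (t x)) (triangle_set (t y)) <-> e x y)].

End Plane.

(** * Random access machines *)

(* The random access machine of Cook and Reckhow (registers indexed by [nat]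
   and holding integers, sequential input and output), extended with the
   one-bit right shift [Half].  There is no multiplication, so charging one
   time unit per instruction is the usual uniform cost measure. *)
Inductive instr :=
  | Const of nat & int          (* X_d <- z *)
  | Add of nat & nat & nat      (* X_d <- X_a + X_b *)
  | Sub of nat & nat & nat      (* X_d <- X_a - X_b *)
  | Half of nat & nat           (* X_d <- floor (X_a / 2) *)
  | Fetch of nat & nat          (* X_d <- X_(X_a) *)
  | Store of nat & nat          (* X_(X_a) <- X_b *)
  | JumpPos of nat & nat        (* if X_a > 0 then go to instruction l *)
  | Read of nat                 (* X_d <- next input item *)
  | Write of nat.               (* append X_a to the output *)

Definition program := seq instr.

Record config := Config {
  pc : nat;
  reg : nat -> int;
  inp : seq int;
  out : seq int
}.

Definition upd (m : nat -> int) (d : nat) (z : int) : nat -> int :=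
  fun i => if i == d then z else m i.

(* [None] on a negative address, on reading past the end of the input, and
   when the program counter has left the program. *)
Definition step (p : program) (c : config) : option config :=
  let: Config k m i o := c in
  if onth p k is Some ins then
    match ins with
    | Const d z => Some (Config k.+1 (upd m d z) i o)
    | Add d a b => Some (Config k.+1 (upd m d (m a + m b)) i o)
    | Sub d a b => Some (Config k.+1 (upd m d (m a - m b)) i o)
    | Half d a => Some (Config k.+1 (upd m d (m a %/ 2)%Z) i o)
    | Fetch d a =>
        if m a is Posz r then Some (Config k.+1 (upd m d (m r)) i o) else None
    | Store a b =>
        if m a is Posz r then Some (Config k.+1 (upd m r (m b)) i o) else None
    | JumpPos a l => Some (Config (if 0 < m a then l else k.+1) m i o)
    | Read d => if i is z :: i' then Some (Config k.+1 (upd m d z) i' o)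
                else None
    | Write a => Some (Config k.+1 m i (rcons o (m a)))
    end
  else None.

Definition start (input : seq int) : config :=
  Config 0 (fun=> 0) input [::].

(* The machine halts when the program counter leaves the program; [t] is then
   the exact number of executed instructions. *)
Definition runs_in (p : program) (input : seq int) (t : nat) (output : seq int) :
  Prop :=
  exists c : config,
    [/\ iter t (obind (step p)) (Some (start input)) = Some c,
        (size p <= pc c)%N & out c = output].

(** * Encodings *)

(* [es] lists each edge of [e] once, in one of its two orientations. *)
Definition edge_list (T : finType) (e : rel T) (es : seq (T * T)) : Prop :=
  [/\ uniq es,
      forall x y, (x, y) \in es -> (y, x) \notin es
    & forall x y, e x y = ((x, y) \in es) || ((y, x) \in es)].

Definition encode_point (k : grid_kind) : lattice_point k -> seq int :=
  match k with
  | Square => fun p => [:: p.1; p.2]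
  | Hexagonal => fun p => [:: p.1.1; p.1.2; (p.2 : nat)%:Z]
  end.

(* The numbers of vertices and of edges, the lattice coordinates of the
   vertices, and the pairs of endpoints of the edges. *)
Definition encode_graph (k : grid_kind) (n : nat) (pos : 'I_n -> lattice_point k)
    (es : seq ('I_n * 'I_n)) : seq int :=
  [:: n%:Z; (size es)%:Z]
    ++ flatten [seq encode_point (pos x) | x <- enum 'I_n]
    ++ flatten [seq [:: (val u.1)%:Z; (val u.2)%:Z] | u <- es].

(* A rational number is output as a numerator followed by a nonzero
   denominator, not necessarily in lowest terms. *)
Definition fraction : Type := int * int.

Definition fraction_val (R : realType) (x : fraction) : R := x.1%:~R / x.2%:~R.

Definition coordinates (A : Type) (t : triangle A) : seq A :=
  let: Triangle p q r := t in [:: p.1; p.2; q.1; q.2; r.1; r.2].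

Definition map_triangle (A B : Type) (f : A -> B) (t : triangle A) :
  triangle B :=
  let: Triangle p q r := t in
  Triangle (f p.1, f p.2) (f q.1, f q.2) (f r.1, f r.2).

Definition encode_triangle (t : triangle fraction) : seq int :=
  flatten [seq [:: x.1; x.2] | x <- coordinates t].

Definition encodes_representation (R : realType) (n : nat) (e : rel 'I_n)
    (output : seq int) : Prop :=
  exists t : 'I_n -> triangle fraction,
    [/\ output = flatten [seq encode_triangle (t x) | x <- enum 'I_n],
        forall x, all (fun y : fraction => y.2 != 0) (coordinates (t x))
      & touching_triangles e (fun x => map_triangle (@fraction_val R) (t x))].

(* Main.v *)
(* The square lattice is the contact graph of a tiling of the plane by rows of
   alternating upward and downward triangles in which the bases of the downward
   triangles are shifted by half a base against those of the upward triangles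
   above them: a triangle meets two others along its slopes and two along its
   base.  The honeycomb lattice is a sublattice of the square lattice.

   An absent edge between two neighbours in a row is realised by moving a base
   corner of the upward triangle inwards.  A triangle without any neighbour
   across its base is lifted off the base line.  The other absent contacts on a
   base line are removed by sliding the point where two downward triangles and
   the apex of an upward one meet along that line, until the overlap shrinks to
   a point; the slopes through that point turn with it, so no other contact is
   lost.  Every triangle depends only on the edges at distance at most two from
   its vertex, hence is computed in constant time from the adjacency lists.

   Two triangles are compared by an integral affine form separating them: they
   do not touch when the form is nonzero at two corners of one of them, and they
   touch when they have two points in common. *)
Require Import Defs.
From mathcomp Require Import zify ring lra.

Set Implicit Arguments.
Unset Strict Implicit.
Unset Printing Implicit Defensive.

(** * A compiler for straight-line code and loops *)

Section Compiler.

Definition memory := nat -> int.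
Definition state : Type := memory * seq int * seq int.
Definition mem (st : state) : memory := st.1.1.
Definition config_at (k : nat) (st : state) : config :=
  Config k st.1.1 st.1.2 st.2.

Definition reach (p : program) (c : config) (t : nat) (c' : config) : Prop :=
  iter t (obind (step p)) (Some c) = Some c'.

Lemma reach_trans p c1 t1 c2 t2 c3 :
  reach p c1 t1 c2 -> reach p c2 t2 c3 -> reach p c1 (t1 + t2) c3.
Proof. by rewrite /reach addnC iterD => ->. Qed.

Definition straight (i : instr) (st : state) : option state :=
  if i is JumpPos _ _ then None
  else omap (fun c => (reg c, inp c, out c)) (step [:: i] (config_at 0 st)).

Lemma straight_step p k i st st' :
  onth p k = Some i -> straight i st = Some st' ->
  step p (config_at k st) = Some (config_at k.+1 st').
Proof.
case: st => [[m s] o]; rewrite /config_at /step /= => ->.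
case: i => //= [d z|d a b|d a b|d a|d a|a b|d|a]; try (by case=> <-).
- by case: (m a) => // r [<-].
- by case: (m a) => // r [<-].
- by case: s => // z s [<-].
Qed.

Definition straight_run (s : program) (st : state) : option state :=
  foldl (fun o i => obind (straight i) o) (Some st) s.

Lemma straight_run_cat s1 s2 st :
  straight_run (s1 ++ s2) st = obind (straight_run s2) (straight_run s1 st).
Proof.
rewrite /straight_run foldl_cat; case: (foldl _ _ s1) => //=.
by elim: s2.
Qed.

Lemma straight_run_cons i s st :
  straight_run (i :: s) st = obind (straight_run s) (straight i st).
Proof. by rewrite -cat1s straight_run_cat. Qed.

Lemma reach_straight pre s post st st' :
  straight_run s st = Some st' ->
  reach (pre ++ s ++ post) (config_at (size pre) st) (size s)
    (config_at (size pre + size s) st').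
Proof.
elim: s pre st => [|i s IH] pre st /=.
  by rewrite /straight_run /= => -[->]; rewrite addn0.
rewrite straight_run_cons; case E: (straight i st) => [st1|//] /= H.
have {H}/IH : straight_run s st1 = Some st' by [].
move=> /(_ (rcons pre i)); rewrite size_rcons cat_rcons addSnnS.
apply: (@reach_trans _ _ 1); rewrite /reach /=.
apply: straight_step E.
by rewrite onth_cat ltnn subnn.
Qed.

(* Addresses below [scratch] hold intermediate results, so that evaluating an
   expression leaves the memory unchanged from [scratch] on. *)
Definition scratch : nat := 32.

(** [Sel] replaces branching: both alternatives are computed and one is picked. Every expression
    thus compiles to straight-line code with a fixed instruction count. *)
Inductive expr :=
  | Lit of int
  | Plus of expr & expr
  | Minus of expr & expr
  | Dbl of expr
  | Hlf of expr
  | At of expr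
  | Sel of expr & expr & expr.

Fixpoint eval (m : memory) (e : expr) : int :=
  match e with
  | Lit z => z
  | Plus a b => (eval m a + eval m b)%R
  | Minus a b => (eval m a - eval m b)%R
  | Dbl a => (eval m a + eval m a)%R
  | Hlf a => (eval m a %/ 2)%Z
  | At a => m `|eval m a|%N
  | Sel c a b => if eval m c == 0%R then eval m a else eval m b
  end.

Fixpoint safe (m : memory) (e : expr) : bool :=
  match e with
  | Lit z => true
  | Plus a b | Minus a b => safe m a && safe m b
  | Dbl a | Hlf a => safe m a
  | At a => safe m a && (scratch%:Z <= eval m a)%R
  | Sel c a b => [&& safe m c, safe m a, safe m b & (0 <= eval m c <= 1)%R]
  end.

(** Bounds the number of cells from the target [d] on that the code may overwrite. The 4 accounts
    for cell [d + 3], where [Sel] stores the address [d]. *)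
Fixpoint width (e : expr) : nat :=
  match e with
  | Lit z => 1
  | Plus a b | Minus a b => maxn (width a) (width b).+1
  | Dbl a | Hlf a | At a => width a
  | Sel c a b => maxn (maxn (width a) (width b).+1) (maxn (width c).+2 4)
  end.

Lemma width_gt0 e : 0 < width e.
Proof. by elim: e => //= *; lia. Qed.

(* [Sel] indexes the pair of consecutive cells [d], [d + 1] by the condition. *)
Fixpoint code (e : expr) (d : nat) : program :=
  match e with
  | Lit z => [:: Const d z]
  | Plus a b => code a d ++ code b d.+1 ++ [:: Add d d d.+1]
  | Minus a b => code a d ++ code b d.+1 ++ [:: Sub d d d.+1]
  | Dbl a => code a d ++ [:: Add d d d]
  | Hlf a => code a d ++ [:: Half d d]
  | At a => code a d ++ [:: Fetch d d]
  | Sel c a b =>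
      code a d ++ code b d.+1 ++ code c d.+2 ++
      [:: Const d.+3 d%:Z; Add d.+2 d.+2 d.+3; Fetch d d.+2]
  end.

Definition agree (m m' : memory) : Prop :=
  forall a, (scratch <= a)%N -> m a = m' a.

Lemma agree_upd m m' a z : agree m m' -> agree (upd m a z) (upd m' a z).
Proof. by move=> H b hb; rewrite /upd; case: eqP => // _; apply: H. Qed.

Lemma agree_scratch m m' a z : (a < scratch)%N -> agree m m' ->
  agree (upd m a z) m'.
Proof.
by move=> ha H b hb; rewrite /upd; case: eqP => [e|_]; [lia | apply: H].
Qed.

(** The cells below [d] survive, so a second operand can be computed at [d + 1] next to the first.
    Values are taken in [m0], because a safe [At] reads only addresses from [scratch] on. *)
Lemma code_correct e d m m0 i o :
  agree m m0 -> safe m0 e -> (d + width e <= scratch)%N ->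
  exists m', [/\ straight_run (code e d) (m, i, o) = Some (m', i, o),
    m' d = eval m0 e, agree m' m0 & forall a, (a < d)%N -> m' a = m a].
Proof.
rewrite /scratch.
elim: e d m => [z|a IHa b IHb|a IHa b IHb|a IHa|a IHa|a IHa|c IHc a IHa b IHb]
  d m H /=.
- move=> _ hd; exists (upd m d z); split=> //.
  + by rewrite /upd eqxx.
  + by apply: agree_scratch => //; rewrite /scratch; lia.
  + by move=> x hx; rewrite /upd; case: eqP => // ?; lia.
- case/andP=> sa sb hw.
  have [||m1 [r1 v1 g1 k1]] := IHa d m H => //; first by lia.
  have [||m2 [r2 v2 g2 k2]] := IHb d.+1 m1 g1 => //; first by lia.
  exists (upd m2 d (m2 d + m2 d.+1)%R).
  rewrite !straight_run_cat r1 /= straight_run_cat r2 /=; split=> //.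
  + by rewrite /upd eqxx v2 k2 // v1.
  + by apply: agree_scratch => //; rewrite /scratch; lia.
  + by move=> x hx; rewrite /upd; case: eqP => [|_]; [lia | rewrite k2 ?k1 //; lia].
- case/andP=> sa sb hw.
  have [||m1 [r1 v1 g1 k1]] := IHa d m H => //; first by lia.
  have [||m2 [r2 v2 g2 k2]] := IHb d.+1 m1 g1 => //; first by lia.
  exists (upd m2 d (m2 d - m2 d.+1)%R).
  rewrite !straight_run_cat r1 /= straight_run_cat r2 /=; split=> //.
  + by rewrite /upd eqxx v2 k2 // v1.
  + by apply: agree_scratch => //; rewrite /scratch; lia.
  + by move=> x hx; rewrite /upd; case: eqP => [|_]; [lia | rewrite k2 ?k1 //; lia].
- move=> sa hw; have [||m1 [r1 v1 g1 k1]] := IHa d m H => //.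
  exists (upd m1 d (m1 d + m1 d)%R); rewrite straight_run_cat r1 /=; split=> //.
  + by rewrite /upd eqxx v1.
  + by apply: agree_scratch => //; rewrite /scratch; have := width_gt0 a; lia.
  + by move=> x hx; rewrite /upd; case: eqP => [|_]; [lia | rewrite k1].
- move=> sa hw; have [||m1 [r1 v1 g1 k1]] := IHa d m H => //.
  exists (upd m1 d (m1 d %/ 2)%Z); rewrite straight_run_cat r1 /=; split=> //.
  + by rewrite /upd eqxx v1.
  + by apply: agree_scratch => //; rewrite /scratch; have := width_gt0 a; lia.
  + by move=> x hx; rewrite /upd; case: eqP => [|_]; [lia | rewrite k1].
- case/andP=> sa ha hw; have [||m1 [r1 v1 g1 k1]] := IHa d m H => //.
  exists (upd m1 d (m1 `|m1 d|%N)); rewrite straight_run_cat r1 /=; split=> //.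
  + rewrite straight_run_cons /= v1; case: (eval m0 a) ha => //= n.
  + rewrite /upd eqxx v1 g1 //; rewrite /scratch in ha *; lia.
  + by apply: agree_scratch => //; rewrite /scratch; have := width_gt0 a; lia.
  + by move=> x hx; rewrite /upd; case: eqP => [|_]; [lia | rewrite k1].
- case/and4P=> sc sa sb hc hw.
  have [||m1 [r1 v1 g1 k1]] := IHa d m H => //; first by lia.
  have [||m2 [r2 v2 g2 k2]] := IHb d.+1 m1 g1 => //; first by lia.
  have [||m3 [r3 v3 g3 k3]] := IHc d.+2 m2 g2 => //; first by lia.
  set m4 := upd (upd m3 d.+3 d%:Z) d.+2 (eval m0 c + d%:Z)%R.
  have e0 : m4 d = eval m0 a.
    rewrite /m4 /upd; case: eqP => [|_]; first by lia.
    case: eqP => [|_]; first by lia.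
    by rewrite k3 ?k2 ?v1 //; lia.
  have e1 : m4 d.+1 = eval m0 b.
    rewrite /m4 /upd; case: eqP => [|_]; first by lia.
    case: eqP => [|_]; first by lia.
    by rewrite k3 ?v2 //; lia.
  exists (upd m4 d (eval m0 (Sel c a b))).
  rewrite !straight_run_cat r1 /= !straight_run_cat r2 /= !straight_run_cat r3 /=.
  split=> //.
  + rewrite !straight_run_cons /= straight_run_cons /= straight_run_cons /=.
    have -> : upd (upd m3 d.+3 d) d.+2 (upd m3 d.+3 d d.+2 + upd m3 d.+3 d d.+3)%R
      = m4.
      rewrite /m4; congr (upd _ _ _); rewrite /upd eqxx.
      by case: eqP => [|_]; [lia | rewrite v3].
    have -> : m4 d.+2 = (eval m0 c + d%:Z)%R by rewrite /m4 /upd eqxx.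
    have [->|->] : eval m0 c = 0%R \/ eval m0 c = 1%R by lia.
      by rewrite add0r /= e0.
    by rewrite -PoszD add1n /= e1.
  + by rewrite /upd eqxx.
  + apply: agree_scratch; first by rewrite /scratch; lia.
    apply: agree_scratch; first by rewrite /scratch; lia.
    by apply: agree_scratch => //; rewrite /scratch; lia.
  + move=> x hx; rewrite /m4 /upd.
    do 3 (case: eqP => [|_]; first by lia).
    by rewrite k3 ?k2 ?k1 //; lia.
Qed.

Inductive stmt :=
  | Asg of expr & expr
  | Inp of expr
  | Outp of expr.

Definition stmt_code (s : stmt) : program :=
  match s with
  | Asg a v => code a 0 ++ code v 1 ++ [:: Store 0 1]
  | Inp a => code a 0 ++ [:: Read 1; Store 0 1]
  | Outp v => code v 0 ++ [:: Write 0]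
  end.

Definition stmt_exec (s : stmt) (st : state) : state :=
  let: (m, i, o) := st in
  match s with
  | Asg a v => (upd m `|eval m a|%N (eval m v), i, o)
  | Inp a => (upd m `|eval m a|%N (head 0%R i), behead i, o)
  | Outp v => (m, i, rcons o (eval m v))
  end.

Definition stmt_safe (s : stmt) (st : state) : bool :=
  let: (m, i, o) := st in
  match s with
  | Asg a v => [&& safe m (At a), safe m v, (width a <= scratch)%N
                 & (width v < scratch)%N]
  | Inp a => [&& safe m (At a), (width a <= scratch)%N & i != [::]]
  | Outp v => safe m v && (width v <= scratch)%N
  end.

(** Compiled code also overwrites scratch cells, which [stmt_exec] does not model; the simulation is
    therefore modulo these cells. *)
Definition similar (st st' : state) : Prop :=
  [/\ agree st.1.1 st'.1.1, st.1.2 = st'.1.2 & st.2 = st'.2].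

Lemma stmt_correct s st st0 :
  similar st st0 -> stmt_safe s st0 ->
  exists2 st', straight_run (stmt_code s) st = Some st'
             & similar st' (stmt_exec s st0).
Proof.
case: st st0 => [[m i] o] [[m0 i0] o0] [/= H -> ->] {i o}.
case: s => [a v|a|v] /=.
- case/and4P=> /andP [sa ha] sv wa wv.
  have [|m1 [r1 v1 g1 k1]] := code_correct (d := 0) i0 o0 H sa => //.
  have [|m2 [r2 v2 g2 k2]] := code_correct (d := 1) i0 o0 g1 sv => //.
  rewrite straight_run_cat r1 /= straight_run_cat r2 /= straight_run_cons /=.
  rewrite k2 // v1 v2; case: (eval m0 a) ha => //= n _.
  by eexists; first reflexivity; split=> //=; apply: agree_upd.
- case/and3P=> /andP [sa ha] wa; case: i0 => // z i0 _.
  have [|m1 [r1 v1 g1 k1]] := code_correct (d := 0) (z :: i0) o0 H sa => //.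
  rewrite straight_run_cat r1 /= straight_run_cons /= straight_run_cons /=.
  rewrite {1}/upd /= v1; case: (eval m0 a) ha => //= n _.
  eexists; first reflexivity; split=> //=; rewrite {2}/upd /=.
  by apply: agree_upd; apply: agree_scratch.
- case/andP=> sv wv.
  have [|m1 [r1 v1 g1 k1]] := code_correct (d := 0) i0 o0 H sv => //.
  rewrite straight_run_cat r1 /= straight_run_cons /= v1.
  by eexists; first reflexivity.
Qed.

Definition block := seq stmt.

Definition block_code (b : block) : program := flatten [seq stmt_code s | s <- b].

Definition block_exec (b : block) (st : state) : state :=
  foldl (fun st s => stmt_exec s st) st b.

Fixpoint block_safe (b : block) (st : state) : bool :=
  if b is s :: b' then stmt_safe s st && block_safe b' (stmt_exec s st)
  else true.

Lemma block_correct b st st0 :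
  similar st st0 -> block_safe b st0 ->
  exists2 st', straight_run (block_code b) st = Some st'
             & similar st' (block_exec b st0).
Proof.
elim: b st st0 => [|s b IH] st st0 H /=; first by exists st.
case/andP=> ss sb; have [st1 r1 H1] := stmt_correct H ss.
have [st2 r2 H2] := IH _ _ H1 sb.
by exists st2; rewrite // /block_code /= straight_run_cat r1.
Qed.

Inductive item :=
  | Block of block
  | While of nat & block.

(** The loop test stands after the body and is first reached by a jump that loading 1 makes
    unconditional, so zero iterations are possible. Jump targets are absolute, whence the start
    address [k]. *)
Definition item_code (k : nat) (it : item) : program :=
  match it with
  | Block b => block_code b
  | While r b =>
      [:: Const 0 1%R; JumpPos 0 (k + 2 + size (block_code b))]
      ++ block_code b ++ [:: JumpPos r (k + 2)]
  end.

Fixpoint compile (k : nat) (its : seq item) : program :=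
  if its is it :: its' then
    item_code k it ++ compile (k + size (item_code k it)) its'
  else [::].

(** A loop with [N] iterations executes two entry instructions, [N] bodies and [N + 1] tests, which
    gives the stated time. *)
Definition item_run (it : item) (st : state) (t : nat) (st' : state) : Prop :=
  match it with
  | Block b =>
      [/\ block_safe b st, t = size (block_code b) & st' = block_exec b st]
  | While r b =>
      exists N, [/\ (scratch <= r)%N,
        forall j, (j < N)%N -> block_safe b (iter j (block_exec b) st) /\
                            (0 < mem (iter j (block_exec b) st) r)%R,
        (mem (iter N (block_exec b) st) r <= 0)%R,
        t = (3 + N * (size (block_code b)).+1)%N
      & st' = iter N (block_exec b) st]
  end.

Lemma item_correct pre it post st st0 t st0' :
  similar st st0 -> item_run it st0 t st0' ->
  exists2 st', reach (pre ++ item_code (size pre) it ++ post)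
      (config_at (size pre) st) t
      (config_at (size pre + size (item_code (size pre) it)) st')
    & similar st' st0'.
Proof.
case: it => [b|r b] /= H.
  case=> sb -> ->; have [st' r' H'] := block_correct H sb.
  by exists st' => //; exact: reach_straight r'.
case=> N [hr hN hex -> ->].
set k := size pre; set s := size (block_code b).
set p := pre ++ _.
have onth_test : onth p (k + 2 + s) = Some (JumpPos r (k + 2)).
  by rewrite /p onth_cat ltnNge -addnA leq_addr /= addKn -/s addnC addn2 /=
    -catA onth_cat -/s ltnn subnn.
have reach_body st1 st2 : straight_run (block_code b) st1 = Some st2 ->
    reach p (config_at (k + 2) st1) s (config_at (k + 2 + s) st2).
  move=> r1; have := reach_straight (pre ++ [:: Const 0 1%R; JumpPos 0 (k + 2 + s)])
    ([:: JumpPos r (k + 2)] ++ post) r1.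
  by rewrite size_cat /= /p -!catA.
(* Induction on the number [j] of iterations still to come, started at the test rather than at the
   body. *)
have loop j st1 : (j <= N)%N -> similar st1 (iter (N - j) (block_exec b) st0) ->
    exists2 st', reach p (config_at (k + 2 + s) st1) (j * s.+1 + 1)
      (config_at (k + 2 + s).+1 st') & similar st' (iter N (block_exec b) st0).
  elim: j st1 => [|j IH] st1 hj H1.
    rewrite subn0 in H1; exists st1 => //.
    rewrite /reach /= onth_test; case: H1 => /(_ r hr) -> _ _.
    by rewrite ltNge hex.
  have [|sj pj] := hN (N - j.+1); first by lia.
  have [st2 r2 H2] := block_correct H1 sj.
  have [||st' r' H'] := IH st2; first by lia.
    by rewrite (_ : N - j = (N - j.+1).+1); [|lia].
  exists st' => //.
  have -> : j.+1 * s.+1 + 1 = 1 + (s + (j * s.+1 + 1)) by lia.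
  apply: reach_trans (reach_trans (reach_body _ _ r2) r').
  rewrite /reach /= onth_test; case: H1 => /(_ r hr) -> _ _.
  by rewrite pj.
pose st1 : state := (upd st.1.1 0 1%R, st.1.2, st.2).
have [||st' r' H'] := loop N st1 => //.
  rewrite subnn /=; case: H => H1 H2 H3; split=> //=.
  exact: agree_scratch.
exists st' => //; rewrite !size_cat /=.
have -> : (k + (size (block_code b) + 1).+2 = (k + 2 + s).+1) by rewrite /s; lia.
have -> : 3 + N * s.+1 = 2 + (N * s.+1 + 1) by lia.
apply: reach_trans r'.
have onth0 : onth p k = Some (Const 0 1%R) by rewrite /p onth_cat ltnn subnn.
have onth1 : onth p k.+1 = Some (JumpPos 0 (k + 2 + s)).
  by rewrite /p onth_cat ltnNge leqnSn /= subSnn.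
apply: (@reach_trans p _ 1 (config_at k.+1 st1)); rewrite /reach /=.
  by rewrite onth0.
by move: onth1 => /= ->.
Qed.

Inductive items_run : seq item -> state -> nat -> state -> Prop :=
  | Items_nil st : items_run [::] st 0 st
  | Items_cons it its st1 t1 st2 t2 st3 :
      item_run it st1 t1 st2 -> items_run its st2 t2 st3 ->
      items_run (it :: its) st1 (t1 + t2) st3.

Lemma compile_correct its input t st :
  items_run its (fun=> 0%R, input, [::]) t st ->
  runs_in (compile 0 its) input t st.2.
Proof.
move=> run.
(* An arbitrary prefix [pre] is needed for the induction, as the code of later items is compiled for
   its absolute position. *)
suff gen pre st0 st1 : similar st1 st0 -> items_run its st0 t st ->
    exists2 st', reach (pre ++ compile (size pre) its) (config_at (size pre) st1)
      t (config_at (size pre + size (compile (size pre) its)) st')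
    & similar st' st.
  have [|st' r [_ _ e]] := gen [::] _ (fun=> 0%R, input, [::]) _ run.
    by split.
  exists (config_at (size (compile 0 its)) st').
  by split=> //; exact: r.
move=> {run input} H run; elim: run pre st1 H => {its t st st0}.
  by move=> st pre st1 H; exists st1; rewrite //= addn0.
move=> it its sa ta sb tb sc ha _ IH pre st1 H /=.
have [st2 r2 H2] := item_correct pre (compile
  (size pre + size (item_code (size pre) it)) its) H ha.
have [st3] := IH (pre ++ item_code (size pre) it) _ H2.
rewrite size_cat -catA => r3 H3; exists st3 => //.
by rewrite size_cat addnA; apply: reach_trans r2 r3.
Qed.

End Compiler.

(** * Separated triangles in the plane *)

Section PlaneGeometry.
Local Open Scope ring_scope.
Local Open Scope classical_set_scope.
Variable R : realType.
Implicit Types (t : triangle R) (v w p q : R * R) (f : R * R * R).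

(* [(a, b, c)] stands for the affine form [a X + b Y + c]. *)
Definition form f v : R := f.1.1 * v.1 + f.1.2 * v.2 + f.2.

Definition corners (A : Type) (t : triangle A) : seq (A * A) :=
  [:: corner1 t; corner2 t; corner3 t].

Lemma closed_form_le0 f : closed [set v | form f v <= 0].
Proof.
apply: (@preimage_closed _ _ (form f) [set x | x <= 0]); last exact: closed_le.
move=> v _; rewrite /form; apply: cvgD; last exact: cvg_cst.
by apply: cvgD; apply: cvgM; try exact: cvg_cst;
  [exact: cvg_fst | exact: cvg_snd].
Qed.

Lemma form_comb f p q r (a b c : R) : a + b + c = 1 ->
  form f (a *: p + b *: q + c *: r) =
  a * form f p + b * form f q + c * form f r.
Proof.
by move=> h; rewrite /form /= /GRing.scale /= (_ : c = 1 - a - b); [ring | rewrite -h; ring].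
Qed.

Lemma triangle_form_le0 f t :
  (forall p, p \in corners t -> form f p <= 0) ->
  closure (triangle_set t) `<=` [set v | form f v <= 0].
Proof.
move=> H; rewrite [X in _ `<=` X](closure_id _).1; last exact: closed_form_le0.
apply: closureS => v; case: t H => p q r H [a [b [c [a0 b0 c0 abc ->]]]].
rewrite /= form_comb // -[leRHS]addr0 -[X in _ <= X + _]addr0.
by rewrite !lerD // mulr_ge0_le0 ?H // !inE eqxx ?orbT.
Qed.

(** From an interior point a small step along the gradient of [f] stays in [A] and strictly
    increases [f], so [f] cannot vanish there. *)
Lemma interior_form_lt0 f (A : set (R * R)) v :
  A `<=` [set v | form f v <= 0] -> f.1 != 0 -> interior A v -> form f v < 0.
Proof.
move=> hA f0 /nbhs_ballP [e /= e0 he].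
set a := f.1.1; set b := f.1.2.
have d0 : 0 < 2 * (1 + `|a| + `|b|) by rewrite mulr_gt0 // ?ltr_wpDr.
(* With this step length both coordinate changes [s * |a|] and [s * |b|] are smaller than the radius
   [e]. *)
set s := e / (2 * (1 + `|a| + `|b|)).
have s0 : 0 < s by rewrite divr_gt0.
have hs : s * (1 + `|a| + `|b|) < e.
  rewrite (_ : s * _ = e / 2); last by rewrite /s; field; lra.
  by lra.
have /hA /= : A (v.1 + s * a, v.2 + s * b).
  have := normr_ge0 a; have := normr_ge0 b => ha hb.
  apply: he; split; rewrite /= /ball /= opprD addNKr normrN normrM gtr0_norm //;
    apply: le_lt_trans hs; rewrite ler_pM2l //; lra.
have : 0 < a ^+ 2 + b ^+ 2.
  rewrite lt_neqAle eq_sym paddr_eq0 ?sqr_ge0 // !sqrf_eq0.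
  rewrite addr_ge0 ?sqr_ge0 // andbT; apply: contra f0 => /andP [a0 b0].
  by rewrite -pair_eqE; apply/andP.
rewrite /form /= -/a -/b; nra.
Qed.

Lemma form_opp f v : form (- f.1.1, - f.1.2, - f.2) v = - form f v.
Proof. by rewrite /form /=; ring. Qed.

Definition separates f t1 t2 : Prop :=
  [/\ f.1 != 0, forall p, p \in corners t1 -> form f p <= 0
    & forall p, p \in corners t2 -> 0 <= form f p].

Lemma separates_sym f t1 t2 :
  separates f t1 t2 -> separates (- f.1.1, - f.1.2, - f.2) t2 t1.
Proof.
case=> f0 h1 h2; split.
- by apply: contra f0; rewrite -!pair_eqE /pair_eq /= !oppr_eq0.
- by move=> p /h2; rewrite form_opp oppr_le0.
- by move=> p /h1; rewrite form_opp oppr_ge0.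
Qed.

Lemma separates_closure f t1 t2 v : separates f t1 t2 ->
  closure (triangle_set t1) v -> closure (triangle_set t2) v -> form f v = 0.
Proof.
move=> s; have [_ h1 _] := s; have [_ h2 _] := separates_sym s.
move=> /(triangle_form_le0 h1) /= v1 /(triangle_form_le0 h2) /= v2.
by apply/eqP; rewrite eq_le v1 -oppr_le0 -form_opp.
Qed.

Lemma separates_interior f t1 t2 : separates f t1 t2 ->
  interior (triangle_set t1) `&` interior (triangle_set t2) = set0.
Proof.
move=> s; rewrite -subset0 => v [v1 v2].
have [f0 h1 _] := s.
have H1 := triangle_form_le0 h1.
have := interior_form_lt0 (subset_trans (@subset_closure _ _) H1) f0 v1.
rewrite (separates_closure s) ?ltxx //;
  by apply: subset_closure; apply: interior_subset.
Qed.

(* On the triangle [t1] the distance to the corner [p] is at most a multiple of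
   [- f], since [f] is negative at the other two corners. *)
Lemma separates_corner f t1 t2 p v : separates f t1 t2 ->
  (forall q, q \in corners t1 -> q != p -> form f q < 0) ->
  closure (triangle_set t1) v -> closure (triangle_set t2) v -> v = p.
Proof.
move=> s hp v1 v2; have fv := separates_closure s v1 v2.
have [_ h1 _] := s.
(* Applied to the four unit vectors along the axes, this forces both coordinates of [v - p] to
   vanish. *)
suff H (a b : R) : a * (v.1 - p.1) + b * (v.2 - p.2) <= 0.
  have := H 1 0; have := H (-1) 0; have := H 0 1; have := H 0 (-1).
  rewrite [v]surjective_pairing [in RHS](surjective_pairing p) => *.
  by congr (_, _); lra.
(* Adding [K] times [f] makes the linear form nonpositive at all corners, hence on the closed
   triangle; at [v] the added term is zero. *)
have [K [K0 hK]] : exists K, 0 <= K /\ forall q, q \in corners t1 ->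
    a * (q.1 - p.1) + b * (q.2 - p.2) + K * form f q <= 0.
  have one q : q \in corners t1 -> exists K, 0 <= K /\ forall K', K <= K' ->
      a * (q.1 - p.1) + b * (q.2 - p.2) + K' * form f q <= 0.
    move=> qt; have [e|qp] := eqVneq q p.
      exists 0; split=> // K' K'0; rewrite e !subrr !mulr0 !add0r -e.
      by rewrite mulr_ge0_le0 // h1.
    have fq := hp q qt qp; set d := _ + _.
    exists (`|d| / - form f q); split; first by rewrite divr_ge0 // oppr_ge0 ltW.
    move=> K'; rewrite ler_pdivrMr ?oppr_gt0 // mulrN => hK.
    by have := ler_norm d; lra.
  have [K1 [K1_0 hK1]] := one (corner1 t1) (mem_head _ _).
  have [|K2 [K2_0 hK2]] := one (corner2 t1); first by rewrite !inE eqxx orbT.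
  have [|K3 [K3_0 hK3]] := one (corner3 t1); first by rewrite !inE eqxx !orbT.
  exists (K1 + K2 + K3); split; first by rewrite !addr_ge0.
  by move=> q; rewrite !inE => /or3P [] /eqP ->; [apply: hK1|apply: hK2|apply: hK3]; lra.
have /triangle_form_le0 /(_ _ v1) /= : forall q, q \in corners t1 ->
    form (a + K * f.1.1, b + K * f.1.2, K * f.2 - a * p.1 - b * p.2) q <= 0.
  by move=> q /hK; apply: le_trans; rewrite /form /=; lra.
have -> : form (a + K * f.1.1, b + K * f.1.2, K * f.2 - a * p.1 - b * p.2) v
  = a * (v.1 - p.1) + b * (v.2 - p.2) + K * form f v by rewrite /form /=; ring.
by rewrite fv mulr0 addr0.
Qed.

Lemma separates_not_touch f t1 t2 p : separates f t1 t2 ->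
  (forall q, q \in corners t1 -> q != p -> form f q < 0) ->
  ~ touch (triangle_set t1) (triangle_set t2).
Proof.
move=> s hp [q [r [qr h]]]; apply: qr.
have at_ a : 0 <= a <= 1 -> (1 - a) *: q + a *: r = p.
  move=> ha; have [|[v1 _] [v2 _]] := h ((1 - a) *: q + a *: r).
    by exists a.
  exact: separates_corner s hp v1 v2.
have := at_ 0; rewrite subr0 scale1r scale0r addr0 => -> //; last by rewrite lexx ler01.
by have := at_ 1; rewrite subrr scale1r scale0r add0r => -> //; rewrite lexx ler01.
Qed.

Lemma triangle_convex t p q : triangle_set t p -> triangle_set t q ->
  segment_set p q `<=` triangle_set t.
Proof.
case: t => x y z [a [b [c [a0 b0 c0 abc ->]]]] [a' [b' [c' [a'0 b'0 c'0 abc' ->]]]].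
move=> _ [s /andP [s0 s1] ->].
exists ((1 - s) * a + s * a'), ((1 - s) * b + s * b'), ((1 - s) * c + s * c').
have s1' : 0 <= 1 - s by rewrite subr_ge0.
split; rewrite ?addr_ge0 ?mulr_ge0 //.
  rewrite [LHS](_ : _ = (1 - s) * (a + b + c) + s * (a' + b' + c')); last by ring.
  by rewrite abc abc'; ring.
by apply: injective_projections; rewrite /= /GRing.scale /=; ring.
Qed.

(** By convexity the segment lies in both triangles, hence on the separating line. Interior points
    of either triangle lie strictly off that line, so the segment runs in both boundaries. *)
Lemma separates_touch f t1 t2 p q : separates f t1 t2 -> p <> q ->
  triangle_set t1 p -> triangle_set t1 q ->
  triangle_set t2 p -> triangle_set t2 q ->
  touch (triangle_set t1) (triangle_set t2).
Proof.
move=> s pq p1 q1 p2 q2; exists p, q; split=> // v hv.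
have v1 := subset_closure (triangle_convex p1 q1 hv).
have v2 := subset_closure (triangle_convex p2 q2 hv).
have fv := separates_closure s v1 v2.
have lt0 f' t t' : separates f' t t' -> interior (triangle_set t) v -> form f' v < 0.
  case=> f0 h _; apply: interior_form_lt0 => //.
  exact: subset_trans (@subset_closure _ _) (triangle_form_le0 h).
split; split=> // /lt0.
  by move/(_ _ _ s); rewrite fv ltxx.
by move/(_ _ _ (separates_sym s)); rewrite form_opp fv oppr0 ltxx.
Qed.

Lemma touch_sym (A B : set (R * R)) : touch A B -> touch B A.
Proof. by case=> p [q [pq h]]; exists p, q; split=> // v /h []. Qed.

End PlaneGeometry.

(** * Rows of integral triangles *)

Section IntegerTriangles.
Local Open Scope ring_scope.
Local Open Scope classical_set_scope.
Variable R : realType.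
Implicit Types (t : triangle int) (p q : int * int) (f : int * int * int).

Definition real_point p : R * R := (p.1%:~R, p.2%:~R).

Definition real_triangle t : triangle R := map_triangle intr t.

Definition int_form (f : int * int * int) p : int :=
  f.1.1 * p.1 + f.1.2 * p.2 + f.2.

Definition real_form (f : int * int * int) : R * R * R :=
  (f.1.1%:~R, f.1.2%:~R, f.2%:~R).

Lemma form_real f p : form (real_form f) (real_point p) = (int_form f p)%:~R.
Proof. by rewrite /form /int_form /= !intrD !intrM. Qed.

Definition apart t1 t2 : Prop :=
  interior (triangle_set (real_triangle t1)) `&`
    interior (triangle_set (real_triangle t2)) = set0 /\
  ~ touch (triangle_set (real_triangle t1)) (triangle_set (real_triangle t2)).

Definition adjoin t1 t2 : Prop :=
  interior (triangle_set (real_triangle t1)) `&`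
    interior (triangle_set (real_triangle t2)) = set0 /\
  touch (triangle_set (real_triangle t1)) (triangle_set (real_triangle t2)).

Lemma apart_sym t1 t2 : apart t1 t2 -> apart t2 t1.
Proof. by case=> h1 h2; split; [rewrite setIC | move/touch_sym]. Qed.

Lemma adjoin_sym t1 t2 : adjoin t1 t2 -> adjoin t2 t1.
Proof. by case=> h1 h2; split; [rewrite setIC | apply: touch_sym]. Qed.

Lemma corners_real t : corners (real_triangle t) = map real_point (corners t).
Proof. by case: t. Qed.

Definition int_separates f t1 t2 : Prop :=
  [/\ f.1 != 0, forall p, p \in corners t1 -> int_form f p <= 0
    & forall p, p \in corners t2 -> 0 <= int_form f p].

Lemma int_separates_real f t1 t2 : int_separates f t1 t2 ->
  separates (real_form f) (real_triangle t1) (real_triangle t2).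
Proof.
case=> f0 h1 h2; split.
- by move: f0; rewrite -!pair_eqE /pair_eq /= !intr_eq0.
- by move=> v; rewrite corners_real => /mapP [p /h1 hp ->{v}]; rewrite form_real lerz0.
- by move=> v; rewrite corners_real => /mapP [p /h2 hp ->{v}]; rewrite form_real ler0z.
Qed.

Lemma apartP f t1 t2 p : int_separates f t1 t2 ->
  (forall q, q \in corners t1 -> q != p -> int_form f q < 0) -> apart t1 t2.
Proof.
move=> /int_separates_real s hp; split; first exact: separates_interior s.
apply: (separates_not_touch s (p := real_point p)) => v.
rewrite corners_real => /mapP [q qt ->{v}] qp; rewrite form_real ltrz0.
by apply: hp => //; apply: contra qp => /eqP ->.
Qed.

(** [a], [b], [c] are barycentric weights that need not sum to 1, which keeps every membership
    condition an integer equation. *)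
Lemma in_real_triangle (p1 p2 p3 p : int * int) (a b c : int) :
  0 <= a -> 0 <= b -> 0 <= c -> 0 < a + b + c ->
  (a + b + c) * p.1 = a * p1.1 + b * p2.1 + c * p3.1 ->
  (a + b + c) * p.2 = a * p1.2 + b * p2.2 + c * p3.2 ->
  triangle_set (real_triangle (Triangle p1 p2 p3)) (real_point p).
Proof.
move=> a0 b0 c0 d0 h1 h2; have [d dE] : exists d, d = a + b + c by eexists.
rewrite -dE in d0 h1 h2.
have d0' : 0 < d%:~R :> R by rewrite ltr0z.
exists (a%:~R / d%:~R), (b%:~R / d%:~R), (c%:~R / d%:~R); split.
- by rewrite divr_ge0 ?ler0z // ltW.
- by rewrite divr_ge0 ?ler0z // ltW.
- by rewrite divr_ge0 ?ler0z // ltW.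
- by rewrite -!mulrDl -!intrD -dE divff // lt0r_neq0.
- have gen (D X A B C U V W : R) : D != 0 -> D * X = A * U + B * V + C * W ->
      X = A / D * U + B / D * V + C / D * W.
    by move=> D0 e; apply: (mulfI D0); rewrite e; field.
  have e (x u v w : int) : d * x = a * u + b * v + c * w -> x%:~R =
    a%:~R / d%:~R * u%:~R + b%:~R / d%:~R * v%:~R + c%:~R / d%:~R * w%:~R :> R.
    move/(congr1 (intr : int -> R)); rewrite !intrD !intrM; apply: gen.
    exact: lt0r_neq0.
  by apply: injective_projections; rewrite /= /GRing.scale /=; apply: e.
Qed.

Lemma adjoinP f t1 t2 p q : int_separates f t1 t2 -> p <> q ->
  triangle_set (real_triangle t1) (real_point p) ->
  triangle_set (real_triangle t1) (real_point q) ->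
  triangle_set (real_triangle t2) (real_point p) ->
  triangle_set (real_triangle t2) (real_point q) -> adjoin t1 t2.
Proof.
move=> /int_separates_real s pq p1 q1 p2 q2.
split; first exact: separates_interior s.
apply: separates_touch s _ p1 q1 p2 q2 => -[/intr_inj e1 /intr_inj e2].
by apply: pq; apply: injective_projections.
Qed.

Lemma in_base (x1 x2 y1 y2 y : int) (p3 : int * int) (x : int) :
  y1 = y -> y2 = y -> x1 < x2 -> x1 <= x -> x <= x2 ->
  triangle_set (real_triangle (Triangle (x1, y1) (x2, y2) p3)) (real_point (x, y)).
Proof.
move=> -> -> h h1 h2.
by apply: (in_real_triangle (a := x2 - x) (b := x - x1) (c := 0)); rewrite /=;
  [lia | lia | lia | lia | ring | ring].
Qed.

Lemma forall_corners (P : int * int -> Prop) (p1 p2 p3 : int * int) :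
  P p1 -> P p2 -> P p3 ->
  forall q, q \in corners (Triangle p1 p2 p3) -> P q.
Proof. by move=> h1 h2 h3 q; rewrite !inE => /or3P [] /eqP ->. Qed.

Definition weakly_separates f t1 t2 : Prop :=
  [/\ f.1 != 0, [/\ int_form f (corner1 t1) <= 0, int_form f (corner2 t1) <= 0
        & int_form f (corner3 t1) <= 0]
    & [/\ 0 <= int_form f (corner1 t2), 0 <= int_form f (corner2 t2)
        & 0 <= int_form f (corner3 t2)]].

Lemma weakly_separatesP f t1 t2 :
  weakly_separates f t1 t2 -> int_separates f t1 t2.
Proof.
by case: t1 t2 => [p1 p2 p3] [q1 q2 q3] [f0 [a1 a2 a3] [b1 b2 b3]]; split=> //;
  apply: forall_corners.
Qed.

(** A triangle with two corners strictly on one side of the separating line meets the line at most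
    in its third corner, which rules out a common segment. *)
Definition two_negative (x y z : int) : Prop :=
  (x < 0 /\ y < 0) \/ (x < 0 /\ z < 0) \/ (y < 0 /\ z < 0).

Lemma apart_left f t1 t2 : weakly_separates f t1 t2 ->
  two_negative (int_form f (corner1 t1)) (int_form f (corner2 t1))
    (int_form f (corner3 t1)) -> apart t1 t2.
Proof.
move=> /weakly_separatesP; case: t1 => p1 p2 p3 s /= [[h1 h2]|[[h1 h2]|[h1 h2]]].
- by apply: (apartP (p := p3) s); apply: forall_corners => //; rewrite eqxx.
- by apply: (apartP (p := p2) s); apply: forall_corners => //; rewrite eqxx.
- by apply: (apartP (p := p1) s); apply: forall_corners => //; rewrite eqxx.
Qed.

Lemma apart_right f t1 t2 : weakly_separates f t1 t2 ->
  two_negative (- int_form f (corner1 t2)) (- int_form f (corner2 t2))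
    (- int_form f (corner3 t2)) -> apart t1 t2.
Proof.
have e p : int_form (- f.1.1, - f.1.2, - f.2) p = - int_form f p.
  by rewrite /int_form /=; ring.
case=> f0 [a1 a2 a3] [b1 b2 b3] h; apply: apart_sym.
apply: (@apart_left (- f.1.1, - f.1.2, - f.2)); last by rewrite !e.
split; [|by rewrite !e !oppr_le0..|by rewrite !e !oppr_ge0].
by apply: contra f0; rewrite -!pair_eqE /pair_eq /= !oppr_eq0.
Qed.

End IntegerTriangles.

(** * Coordinates of the rows, and contacts between pairs of row triangles *)

Section Strips.
Local Open Scope ring_scope.
Variable R : realType.
Implicit Types (k y p pl pr : int) (l r h : bool).

(* The base [b1, b2] and the apex [a] are given in quarter units; [h] tells
   whether the base is moved a quarter of the height towards the apex. *)
Definition tri (a b1 b2 ya yb : int) (h : bool) : triangle int :=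
  Triangle (4 * b1 + (if h then a - b1 else 0), yb)
           (4 * b2 + (if h then a - b2 else 0), yb) (4 * a, ya).

(* [l] and [r] detach the slopes, and [p], [pl], [pr] in [-1, 1] are the shifts
   of the points on the upper line of the row, in half bases. *)
Definition up (k y : int) (l r h : bool) (p : int) : triangle int :=
  tri (8 * k + 4 + 4 * p) (8 * k + l%:Z) (8 * k + 8 - r%:Z)
    (4 * y + 4) (4 * y + h%:Z) h.

Definition down (k y : int) (h : bool) (pl pr : int) : triangle int :=
  tri (8 * k + 8) (8 * k + 4 + 4 * pl) (8 * k + 12 + 4 * pr)
    (4 * y) (4 * y + 4 - h%:Z) h.

Ltac crunch :=
  rewrite /weakly_separates /two_negative /int_form /=;
  repeat split;
  repeat match goal with
    | |- context [nat_of_bool ?b] => is_var b; case: b => /=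
    | |- context [if ?b then _ else _] => is_var b; case: b => /=
    end; lia.

(** The vertical line through the right end of the [k]-th undetached base separates. Both triangles
    can have a side on it only if the two apexes lean towards each other onto that line, which is
    the excluded case. *)
Lemma up_up k k' y l r h p l' r' h' p' : k < k' ->
  -1 <= p <= 1 -> -1 <= p' <= 1 -> ~ (k' = k + 1 /\ p = 1 /\ p' = -1) ->
  apart R (up k y l r h p) (up k' y l' r' h' p').
Proof.
move=> hk hp hp' ne.
have [p1|[-> p1]] : p < 1 \/ (p = 1 /\ (k' = k + 1 -> -1 < p')) by lia.
- by apply: (@apart_left R (1, 0, - (32 * k + 32))); crunch.
- by apply: (@apart_right R (1, 0, - (32 * k + 32))); crunch.
Qed.

Lemma up_down k k' y l r h p h' pl pr : k < k' ->
  -1 <= p <= 1 -> -1 <= pl <= 1 -> -1 <= pr <= 1 ->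
  apart R (up k y l r h p) (down k' y h' pl pr).
Proof.
move=> hk hp hl hr.
by apply: (@apart_right R (1, 0, - (32 * k + 32))); crunch.
Qed.

Lemma down_up k k' y l r h p h' pl pr : k + 1 < k' ->
  -1 <= p <= 1 -> -1 <= pl <= 1 -> -1 <= pr <= 1 ->
  apart R (down k y h' pl pr) (up k' y l r h p).
Proof.
move=> hk hp hl hr.
by apply: (@apart_left R (1, 0, - (32 * k + 64))); crunch.
Qed.

(** The separating line joins the right end of the left triangle's unlifted base to a point of the
    lower line strictly between the apexes of [down k] and [down (k + 1)]. The left triangle meets
    it at most in that end. *)
Lemma down_down k k' y h pl pr h' pl' pr' : k < k' ->
  -1 <= pl <= 1 -> -1 <= pr <= 1 -> -1 <= pl' <= 1 -> -1 <= pr' <= 1 ->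
  ~ (pl = 1 /\ pr = -1) -> (k' = k + 1 -> pr <= pl') ->
  apart R (down k y h pl pr) (down k' y h' pl' pr').
Proof.
move=> hk hl hr hl' hr' ne hlr.
have [?|[?|?]] : pr = -1 \/ pr = 0 \/ pr = 1 by lia.
- by subst pr; apply: (@apart_left R (4, 8, - (32 * y) - 4 * (32 * k + 40))); crunch.
- by subst pr; apply: (@apart_left R (4, -8, 32 * y - 4 * (32 * k + 40))); crunch.
- by subst pr; apply: (@apart_left R (4, -24, 96 * y - 4 * (32 * k + 40))); crunch.
Qed.

(** The separating line carries the slope the upward triangle would have if attached. Its moved base
    corner is strictly off that line, so only the apex can remain on it. *)
Lemma up_down_apart k y l h p h' pl pr :
  -1 <= p <= 1 -> -1 <= pl <= 1 -> -1 <= pr <= 1 -> p <= pl ->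
  apart R (up k y l true h p) (down k y h' pl pr).
Proof.
move=> hp hl hr le.
have [?|[?|?]] : p = -1 \/ p = 0 \/ p = 1 by lia.
- by subst p; apply: (@apart_left R (4, 32, - (128 * y) - 4 * (32 * k + 32))); crunch.
- by subst p; apply: (@apart_left R (4, 16, - (64 * y) - 4 * (32 * k + 32))); crunch.
- by subst p; apply: (@apart_left R (4, 0, - 4 * (32 * k + 32))); crunch.
Qed.

(** Here the line carries the right slope of the downward triangle; both base corners of the upward
    one lie strictly beyond it. *)
Lemma down_up_apart k y r h p h' pl pr :
  -1 <= p <= 1 -> -1 <= pl <= 1 -> -1 <= pr <= 1 -> pr <= p ->
  apart R (down k y h' pl pr) (up (k + 1) y true r h p).
Proof.
move=> hp hl hr le.
have [?|[?|?]] : pr = -1 \/ pr = 0 \/ pr = 1 by lia.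
- by subst pr; apply: (@apart_right R (4, 0, - 4 * (32 * k + 32))); crunch.
- by subst pr; apply: (@apart_right R (4, -16, 64 * y - 4 * (32 * k + 32))); crunch.
- by subst pr; apply: (@apart_right R (4, -32, 128 * y - 4 * (32 * k + 32))); crunch.
Qed.

Lemma up_down_adjoin k y l h p h' pr :
  -1 <= p <= 1 -> -1 <= pr <= 1 ->
  adjoin R (up k y l false h p) (down k y h' p pr).
Proof.
move=> hp hr.
(* The witnesses lie on the common slope at one and three quarters of the height. Both survive
   lifting: a lifted upward base is at height 1, a lifted downward base at height 3. *)
apply: (adjoinP (p := (32 * k + 28 + 4 * p, 4 * y + 1))
          (q := (32 * k + 20 + 12 * p, 4 * y + 3))
          (f := (4, 16 - 16 * p, 4 * (16 * p - 16) * y - 4 * (32 * k + 32)))).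
- apply: weakly_separatesP.
  by have [->|[->|->]] : p = -1 \/ p = 0 \/ p = 1 by [lia]; crunch.
- by case; lia.
- by apply: (in_real_triangle R (a := 0) (b := if h then 1 else 3)
    (c := if h then 0 else 1)); case: h => /=; lia.
- by apply: (in_real_triangle R (a := 0) (b := 1)
    (c := if h then 2 else 3)); case: h => /=; lia.
- by apply: (in_real_triangle R (a := 1) (b := 0)
    (c := if h' then 2 else 3)); case: h' => /=; lia.
- by apply: (in_real_triangle R (a := if h' then 1 else 3) (b := 0)
    (c := if h' then 0 else 1)); case: h' => /=; lia.
Qed.

Lemma down_up_adjoin k y r h p h' pl :
  -1 <= p <= 1 -> -1 <= pl <= 1 ->
  adjoin R (down k y h' pl p) (up (k + 1) y false r h p).
Proof.
move=> hp hl.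
apply: (adjoinP (p := (32 * k + 36 + 4 * p, 4 * y + 1))
          (q := (32 * k + 44 + 12 * p, 4 * y + 3))
          (f := (4, - (16 + 16 * p), 4 * (16 * p + 16) * y - 4 * (32 * k + 32)))).
- apply: weakly_separatesP.
  by have [->|[->|->]] : p = -1 \/ p = 0 \/ p = 1 by [lia]; crunch.
- by case; lia.
- by apply: (in_real_triangle R (a := 0) (b := 1)
    (c := if h' then 2 else 3)); case: h' => /=; lia.
- by apply: (in_real_triangle R (a := 0) (b := if h' then 1 else 3)
    (c := if h' then 0 else 1)); case: h' => /=; lia.
- by apply: (in_real_triangle R (a := if h then 1 else 3) (b := 0)
    (c := if h then 0 else 1)); case: h => /=; lia.
- by apply: (in_real_triangle R (a := 1) (b := 0)
    (c := if h then 2 else 3)); case: h => /=; lia.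
Qed.

(** Only the apex of an upward triangle reaches the upper line of its row, so a higher row meets it
    in at most one point. *)
Lemma up_below k k' y y' l r h p l' r' h' p' : y < y' ->
  -1 <= p <= 1 -> -1 <= p' <= 1 ->
  apart R (up k y l r h p) (up k' y' l' r' h' p').
Proof. by move=> hy hp hp'; apply: (@apart_left R (0, 1, - (4 * y'))); crunch. Qed.

Lemma up_below_down k k' y y' l r h p h' pl pr : y < y' ->
  apart R (up k y l r h p) (down k' y' h' pl pr).
Proof. by move=> hy; apply: (@apart_left R (0, 1, - (4 * y'))); crunch. Qed.

Lemma down_below k k' y y' h pl pr h' pl' pr' : y < y' ->
  apart R (down k y h pl pr) (down k' y' h' pl' pr').
Proof. by move=> hy; apply: (@apart_right R (0, 1, - (4 * y'))); crunch. Qed.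

Lemma down_far_below k k' y y' l r h p h' pl pr : y + 1 < y' ->
  apart R (down k y h' pl pr) (up k' y' l r h p).
Proof. by move=> hy; apply: (@apart_left R (0, 1, - (4 * y'))); crunch. Qed.

(** If one base is lifted, the base line separates. Otherwise the base line contains two corners of
    each triangle, and an oblique line through the end of the upward base where the two bases at
    most meet is used instead. *)
Lemma down_below_apart k k' y l r h p h' pl pr :
  -1 <= p <= 1 -> -1 <= pl <= 1 -> -1 <= pr <= 1 -> ~ (pl = 1 /\ pr = -1) ->
  (k' = k -> h || h' \/ pl = 1) -> (k' = k + 1 -> h || h' \/ pr = -1) ->
  apart R (down k y h' pl pr) (up k' (y + 1) l r h p).
Proof.
move=> hp hl hr ne h0 h1; have [hh|hh] := boolP (h || h').
  have [hh1|hh1] := orP hh; rewrite hh1.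
    by apply: (@apart_right R (0, 1, - (4 * (y + 1)))); crunch.
  by apply: (@apart_left R (0, 1, - (4 * (y + 1)))); crunch.
move: hh h0 h1; rewrite negb_or => /andP [/negbTE -> /negbTE ->] h0 h1.
have [hk|hk] : k' <= k \/ k < k' by lia.
  have {}h0 : k' = k -> pl = 1 by move=> /h0 [].
  by apply: (@apart_left R (-1, 1, - (4 * y + 4) + 32 * k' + 32)); crunch.
have {}h1 : k' = k + 1 -> pr = -1 by move=> /h1 [].
by apply: (@apart_left R (1, 1, - (4 * y + 4) - 32 * k')); crunch.
Qed.

Lemma down_below_left_adjoin k y l r p pl pr :
  -1 <= p <= 1 -> -1 <= pl <= 0 -> -1 <= pr <= 1 ->
  adjoin R (down k y false pl pr) (up k (y + 1) l r false p).
Proof.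
move=> hp hl hr.
(* The right witness stays 4 short of the base end [32 * k + 32], because a detached right slope
   moves that corner inwards by 4. *)
apply: (adjoinP (p := (32 * k + 16, 4 * (y + 1))) (q := (32 * k + 28, 4 * (y + 1)))
          (f := (0, 1, - (4 * (y + 1))))).
- by apply: weakly_separatesP; crunch.
- by case; lia.
- by apply: in_base; crunch.
- by apply: in_base; crunch.
- by apply: in_base; crunch.
- by apply: in_base; crunch.
Qed.

Lemma down_below_right_adjoin k y l r p pl pr :
  -1 <= p <= 1 -> -1 <= pl <= 1 -> 0 <= pr <= 1 ->
  adjoin R (down k y false pl pr) (up (k + 1) (y + 1) l r false p).
Proof.
move=> hp hl hr.
apply: (adjoinP (p := (32 * k + 40, 4 * (y + 1))) (q := (32 * k + 48, 4 * (y + 1)))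
          (f := (0, 1, - (4 * (y + 1))))).
- by apply: weakly_separatesP; crunch.
- by case; lia.
- by apply: in_base; crunch.
- by apply: in_base; crunch.
- by apply: in_base; crunch.
- by apply: in_base; crunch.
Qed.

Lemma nondegenerate_real (x1 x2 y1 y2 : int) (p : int * int) :
  y1 = y2 -> x1 < x2 -> y1 != p.2 ->
  nondegenerate (real_triangle R (Triangle (x1, y1) (x2, y2) p)).
Proof.
move=> -> h1 h2; rewrite /= subrr mul0r subr0 mulf_neq0 // -intrB intr_eq0 subr_eq0.
  by rewrite gt_eqF.
by rewrite eq_sym.
Qed.

Lemma up_nondegenerate k y l r h p :
  nondegenerate (real_triangle R (up k y l r h p)).
Proof. by apply: nondegenerate_real; crunch. Qed.

Lemma down_nondegenerate k y h pl pr :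
  -1 <= pl <= 1 -> -1 <= pr <= 1 -> ~ (pl = 1 /\ pr = -1) ->
  nondegenerate (real_triangle R (down k y h pl pr)).
Proof. by move=> hl hr ne; apply: nondegenerate_real; crunch. Qed.

End Strips.

(** * The layout of a subgraph of the lattice of rows *)

Section Layout.
Local Open Scope ring_scope.
Variables (R : realType) (T : finType) (e : rel T).

(* [(k, y, b)] is the [k]-th upward ([b = false]) or downward ([b = true])
   triangle of row [y].  The slots 0 and 1 lead across the slopes, the slots 2
   and 3 across the base; each slot is its own reverse. *)
Definition next (p : int * int * bool) (s : nat) : int * int * bool :=
  let: (k, y, b) := p in
  let dk := (odd s)%:Z in
  let dy := (1 < s)%N%:Z in
  if b then (k + dk, y + dy, false) else (k - dk, y - dy, true).

Lemma nextK p s : next (next p s) s = p.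
Proof. by case: p => [[k y] []]; rewrite /next ?subrK ?addrK. Qed.

Lemma next_slot p s s' : (s < 4)%N -> (s' < 4)%N -> next p s = next p s' -> s = s'.
Proof.
by case: p => [[k y] []] h h' /= [e1 e2];
  move: h h' e1 e2; case: s => [|[|[|[|?]]]] //; case: s' => [|[|[|[|?]]]] //=; lia.
Qed.

Definition strip_adj (p q : int * int * bool) : bool :=
  [exists s : 'I_4, q == next p s].

Variable pos : T -> int * int * bool.

Definition nbr (x : T) (s : nat) : option T :=
  [pick y | e x y && (pos y == next (pos x) s)].

Definition flat (x : T) : bool := nbr x 2 || nbr x 3.

(* A downward triangle that keeps only one of its two base contacts wants the
   end of its base at the absent contact moved inwards; one that has neither is
   lifted instead, so that opposite moves never squeeze it to a point. *)
Definition shift_right (o : option T) : bool :=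
  if o is Some z then ~~ nbr z 2 && nbr z 3 else false.

Definition shift_left (o : option T) : bool :=
  if o is Some z then nbr z 2 && ~~ nbr z 3 else false.

(** At a point on a base line, [o] is the downward triangle to its right and [o'] the one to its
    left. Opposite wishes may cancel: both then lack contact with the same upward triangle across
    the line, which, if present, is lifted. *)
Definition shift (o o' : option T) : int :=
  (shift_right o)%:Z - (shift_left o')%:Z.

(** A downward triangle sees the other base ending at the same point only through the upward
    triangle with its apex there. If a link is missing the shifts may differ, but then they only
    move the two downward bases apart. *)
Definition layout (x : T) : triangle int :=
  let: (k, y, b) := pos x in
  if b then
    down k y (~~ flat x) (shift (Some x) (obind (nbr^~ 1%N) (nbr x 0)))
      (shift (obind (nbr^~ 0%N) (nbr x 1)) (Some x))
  else
    up k y (~~ nbr x 1) (~~ nbr x 0) (~~ flat x) (shift (nbr x 0) (nbr x 1)).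

Hypotheses (e_sym : symmetric e) (pos_inj : injective pos).
Hypothesis e_adj : forall x y, e x y -> strip_adj (pos x) (pos y).

Lemma nbrP x s y : nbr x s = Some y <-> e x y /\ pos y = next (pos x) s.
Proof.
rewrite /nbr; split.
  by case: pickP => // z /andP [exz /eqP pz] [<-].
case=> exy py; case: pickP => [z /andP [_ /eqP pz]|/(_ y)].
  by congr Some; apply: pos_inj; rewrite pz py.
by rewrite exy py eqxx.
Qed.

Lemma nbr_sym x s y : nbr x s = Some y -> nbr y s = Some x.
Proof. by move/nbrP => [exy py]; apply/nbrP; rewrite e_sym py nextK. Qed.

Lemma nbr_edge x y s : pos y = next (pos x) s -> e x y -> nbr x s = Some y.
Proof. by move=> py exy; apply/nbrP. Qed.

Lemma nbr_nonedge x y s : pos y = next (pos x) s -> ~~ e x y -> nbr x s = None.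
Proof.
move=> py /negP nexy; case E: (nbr x s) => [z|//].
have [exz pz] := (nbrP _ _ _).1 E.
by case: nexy; rewrite (pos_inj (etrans py (esym pz))).
Qed.

Lemma adj_next x y : e x y -> exists2 s, (s < 4)%N & pos y = next (pos x) s.
Proof. by move/e_adj => /existsP [s /eqP ->]; exists s. Qed.

Lemma shift_bounds o o' : -1 <= shift o o' <= 1.
Proof. by rewrite /shift; case: shift_right; case: shift_left. Qed.

(** Moving the left end inwards requires slot 2 to be empty, moving the right end inwards requires
    it to be filled; so a base never collapses. *)
Lemma shift_opp x o o' : ~ (shift (Some x) o = 1 /\ shift o' (Some x) = -1).
Proof.
rewrite /shift /=.
by case: (nbr x 2); case: (nbr x 3); case: shift_left; case: shift_right => /=; lia.
Qed.

Definition resolved (x y : T) : Prop :=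
  if e x y then adjoin R (layout x) (layout y) else apart R (layout x) (layout y).

Lemma resolved_sym x y : resolved x y -> resolved y x.
Proof.
by rewrite /resolved e_sym; case: ifP => _; [apply: adjoin_sym | apply: apart_sym].
Qed.

Lemma apart_resolved x y : (forall s, (s < 4)%N -> pos y <> next (pos x) s) ->
  apart R (layout x) (layout y) -> resolved x y.
Proof. by move=> h; rewrite /resolved; case: ifP => // /adj_next [s /h]. Qed.

Lemma resolved_up_up x x' k y k' y' : pos x = (k, y, false) ->
  pos x' = (k', y', false) -> (y < y') || ((y == y') && (k < k')) ->
  resolved x x'.
Proof.
move=> px px' h; apply: apart_resolved; first by move=> s _; rewrite px px'.
rewrite /layout px px'; case/orP: h => [hy|/andP [/eqP ey hk]].
  by apply: up_below => //; apply: shift_bounds.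
rewrite -ey; apply: up_up => //; try exact: shift_bounds.
(* Apexes leaning towards each other would both be moved by the downward triangle between them,
   collapsing its base. *)
case=> ek [e1 e2].
have [z [z1 z2]] : exists z, nbr x 0 = Some z /\ nbr x' 1 = Some z.
  move: e1; rewrite /shift; case E: (nbr x 0) => [z|] /=; last by case: shift_left.
  move=> _; exists z; split=> //.
  move: e2; rewrite /shift; case E': (nbr x' 1) => [z'|] /=; last by case: shift_right.
  move=> _; congr Some; apply: pos_inj.
  have [_ ->] := (nbrP _ _ _).1 E; have [_ ->] := (nbrP _ _ _).1 E'.
  by rewrite px px' /=; congr (_, _, _); lia.
by apply: (@shift_opp z (nbr x 1) (nbr x' 0)); rewrite -{1}z1 -z2.
Qed.

Lemma resolved_down_down z z' k y k' y' : pos z = (k, y, true) ->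
  pos z' = (k', y', true) -> (y < y') || ((y == y') && (k < k')) ->
  resolved z z'.
Proof.
move=> pz pz' h; apply: apart_resolved; first by move=> s _; rewrite pz pz'.
rewrite /layout pz pz'; case/orP: h => [hy|/andP [/eqP ey hk]].
  exact: down_below.
rewrite -ey; apply: down_down => //; try exact: shift_bounds.
  exact: shift_opp.
(* If the upward triangle between the two is linked to both, the two shifts coincide; otherwise the
   right shift of [z] is at most 0 and the left shift of [z'] at least 0. *)
move=> ek.
case E: (nbr z 1) => [x|] /=; last first.
  case E': (nbr z' 0) => [x'|] /=; last first.
    by rewrite /shift /=; case: (_ && _); case: (_ && _).
  case E2: (nbr x' 1) => [z2|]; last first.
    by rewrite /shift /=; case: (_ && _); case: (_ && _).
  have [_ pz2] := (nbrP _ _ _).1 E2; have [_ px'] := (nbrP _ _ _).1 E'.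
  suff ezz2 : z2 = z by have := nbr_sym E2; rewrite ezz2 E.
  apply: pos_inj; rewrite pz2 px' pz' pz /=; congr (_, _, _); lia.
have Ex := nbr_sym E; have [_ px] := (nbrP _ _ _).1 E; rewrite pz /= in px.
case E0: (nbr x 0) => [z2|]; last first.
  case E': (nbr z' 0) => [x'|] /=; last first.
    by rewrite /shift /=; case: (_ && _); case: (_ && _).
  have [_ px'] := (nbrP _ _ _).1 E'.
  have exx' : x' = x.
    by apply: pos_inj; rewrite px' px pz' /=; congr (_, _, _); lia.
  by have := nbr_sym E'; rewrite exx' E0.
have [_ pz2] := (nbrP _ _ _).1 E0.
have ez2 : z2 = z'.
  by apply: pos_inj; rewrite pz2 px pz' /=; congr (_, _, _); lia.
by rewrite -ez2 (nbr_sym E0) /= Ex.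
Qed.

Lemma resolved_up_down x z k y k' y' : pos x = (k, y, false) ->
  pos z = (k', y', true) -> resolved x z.
Proof.
move=> px pz.
(* Outside the four positions reached by [next] there can be no edge, so separation suffices. *)
have far : ~ (y' = y /\ (k' = k \/ k' = k - 1)) ->
    ~ (y' = y - 1 /\ (k' = k \/ k' = k - 1)) ->
    apart R (layout x) (layout z) -> resolved x z.
  move=> h1 h2; apply: apart_resolved => -[|[|[|[|s]]]] // _;
    rewrite px pz /= => -[]; lia.
have lay : layout x = up k y (~~ nbr x 1) (~~ nbr x 0) (~~ flat x)
  (shift (nbr x 0) (nbr x 1)) by rewrite /layout px.
have laz : layout z = down k' y' (~~ flat z)
  (shift (Some z) (obind (nbr^~ 1%N) (nbr z 0)))
  (shift (obind (nbr^~ 0%N) (nbr z 1)) (Some z)) by rewrite /layout pz.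
have [hy|[ey|[ey|hy]]] : y < y' \/ y' = y \/ y' = y - 1 \/ y' + 1 < y by lia.
- apply: far; [lia | lia |]; rewrite lay laz; exact: up_below_down.
- have [hk|[ek|[ek|hk]]] : k < k' \/ k' = k \/ k' = k - 1 \/ k' + 1 < k by lia.
  + apply: far; [lia | lia |]; rewrite lay laz ey.
    by apply: up_down => //; apply: shift_bounds.
  + have slot : pos z = next (pos x) 0 by rewrite px pz ey ek /= !subr0.
    have slot' : pos x = next (pos z) 0 by rewrite slot nextK.
    rewrite /resolved lay laz ey ek; case: ifP => exz.
      rewrite (nbr_edge slot exz) (nbr_edge slot') 1?e_sym //=.
      by apply: up_down_adjoin; apply: shift_bounds.
    move/negbT: exz => exz; rewrite (nbr_nonedge slot exz) (nbr_nonedge slot') 1?e_sym //=.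
    apply: up_down_apart; try exact: shift_bounds.
    (* Without the link the apex can only move left and the base end only right. *)
    by rewrite /shift /=; case: (_ && _); case: shift_left.
  + have slot : pos z = next (pos x) 1 by rewrite px pz ey ek /= subr0.
    have slot' : pos x = next (pos z) 1 by rewrite slot nextK.
    rewrite /resolved lay laz ey (_ : k = k' + 1); last by lia.
    case: ifP => exz.
      rewrite (nbr_edge slot exz) (nbr_edge slot') 1?e_sym //=.
      by apply/adjoin_sym/down_up_adjoin; apply: shift_bounds.
    move/negbT: exz => exz; rewrite (nbr_nonedge slot exz) (nbr_nonedge slot') 1?e_sym //=.
    apply/apart_sym/down_up_apart; try exact: shift_bounds.
    by rewrite /shift /=; case: (_ && _); case: shift_right.
  + apply: far; [lia | lia |]; rewrite lay laz ey; apply: apart_sym.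
    by apply: down_up => //; apply: shift_bounds.
- have ey' : y = y' + 1 by lia.
  have [exz|exz] := boolP (e x z); last first.
    rewrite /resolved (negbTE exz); apply: apart_sym; rewrite lay laz ey'.
    apply: down_below_apart; try exact: shift_bounds.
    * exact: shift_opp.
    * move=> ek.
      have slot : pos z = next (pos x) 2 by rewrite px pz ey ek /= subr0.
      have slot' : pos x = next (pos z) 2 by rewrite slot nextK.
      have xz := nbr_nonedge slot exz.
      have zx : nbr z 2 = None by apply: nbr_nonedge slot' _; rewrite e_sym.
      (* A triangle without base contact is lifted. Otherwise [z] asks for a move to the right, and
         the only possible opponent [z'] keeps its contact with [x], so it makes no opposite
         request. *)
      rewrite /flat xz zx /=.
      case Z3: (nbr z 3) => [w|] /=; last by left; rewrite orbT.
      case X3: (nbr x 3) => [w'|] /=; last by left.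
      right; rewrite /shift /= zx Z3 /=.
      case Z0: (nbr z 0) => [x0|] //=; case X0: (nbr x0 1) => [z'|] //=.
      case Z2: (nbr z' 3) => [w2|]; rewrite ?andbF //=.
      suff e' : z' = w' by rewrite e' (nbr_sym X3) in Z2.
      apply: pos_inj; have [_ ->] := (nbrP _ _ _).1 X0.
      have [_ ->] := (nbrP _ _ _).1 Z0; have [_ ->] := (nbrP _ _ _).1 X3.
      by rewrite px pz /=; congr (_, _, _); lia.
    * move=> ek.
      have slot : pos z = next (pos x) 3 by rewrite px pz ek /=; congr (_, _, _); lia.
      have slot' : pos x = next (pos z) 3 by rewrite slot nextK.
      have xz := nbr_nonedge slot exz.
      have zx : nbr z 3 = None by apply: nbr_nonedge slot' _; rewrite e_sym.
      rewrite /flat xz zx /= !orbF.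
      case Z2: (nbr z 2) => [w|] /=; last by left; rewrite orbT.
      case X2: (nbr x 2) => [w'|] /=; last by left.
      right; rewrite /shift /= zx Z2 /=.
      case Z1: (nbr z 1) => [x1|] //=; case X1: (nbr x1 0) => [z'|] //=.
      case Z2': (nbr z' 2) => [w2|]; rewrite ?andbF //=.
      suff e' : z' = w' by rewrite e' (nbr_sym X2) in Z2'.
      apply: pos_inj; have [_ ->] := (nbrP _ _ _).1 X1.
      have [_ ->] := (nbrP _ _ _).1 Z1; have [_ ->] := (nbrP _ _ _).1 X2.
      by rewrite px pz /=; congr (_, _, _); lia.
  have [s s4 slot] := adj_next exz.
  have slot' : pos x = next (pos z) s by rewrite slot nextK.
  have xs := nbr_edge slot exz.
  have zs : nbr z s = Some x by apply: nbr_edge slot' _; rewrite e_sym.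
  rewrite /resolved exz; apply: adjoin_sym; rewrite lay laz ey'.
  move: s4 slot xs zs {slot'}; rewrite px pz.
  case: s => [|[|[|[|s]]]] // _ [] /=; try lia; move=> ek _ xs zs.
  + rewrite /flat xs zs /= (_ : k = k'); last by lia.
    (* The left shift is at most 0, since [z] keeps slot 2 and does not ask to move that end
       inwards. *)
    apply: down_below_left_adjoin; try exact: shift_bounds.
    by rewrite /shift /= zs /=; case: shift_left.
  + rewrite /flat xs zs !orbT /= (_ : k = k' + 1); last by lia.
    apply: down_below_right_adjoin; try exact: shift_bounds.
    by rewrite /shift /= zs andbF /=; case: shift_right.
- apply: far; [lia | lia |]; rewrite lay laz; apply: apart_sym.
  exact: down_far_below.
Qed.

Lemma layout_resolved x y : x != y -> resolved x y.
Proof.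
case px: (pos x) => [[k1 y1] []]; case py: (pos y) => [[k2 y2] []] xy.
- have [h|[h|[h h']]] : (y1 < y2) || ((y1 == y2) && (k1 < k2)) \/
    (y2 < y1) || ((y2 == y1) && (k2 < k1)) \/ y1 = y2 /\ k1 = k2 by lia.
  + exact: resolved_down_down px py h.
  + exact/resolved_sym/(resolved_down_down py px h).
  + by case/eqP: xy; apply: pos_inj; rewrite px py h h'.
- exact/resolved_sym/(resolved_up_down py px).
- exact: resolved_up_down px py.
- have [h|[h|[h h']]] : (y1 < y2) || ((y1 == y2) && (k1 < k2)) \/
    (y2 < y1) || ((y2 == y1) && (k2 < k1)) \/ y1 = y2 /\ k1 = k2 by lia.
  + exact: resolved_up_up px py h.
  + exact/resolved_sym/(resolved_up_up py px h).
  + by case/eqP: xy; apply: pos_inj; rewrite px py h h'.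
Qed.

Lemma layout_touching :
  touching_triangles e (fun x => real_triangle R (layout x)).
Proof.
split.
- move=> x; rewrite /layout; case: (pos x) => [[k y] []].
    by apply: down_nondegenerate; [exact: shift_bounds..|exact: shift_opp].
  exact: up_nondegenerate.
- by move=> x y /layout_resolved; rewrite /resolved; case: ifP => _ [].
- by move=> x y /layout_resolved; rewrite /resolved; case: ifP => _ [].
Qed.

End Layout.

(** * Weakest preconditions *)

Section Specifications.

Definition evals (m : memory) (e : expr) (z : int) : Prop :=
  safe m e /\ eval m e = z.

Lemma evals_lit m z : evals m (Lit z) z.
Proof. by []. Qed.

Lemma evals_plus m a b x y :
  evals m a x -> evals m b y -> evals m (Plus a b) (x + y)%R.
Proof. by case=> sa ea [sb eb]; split; rewrite /= ?sa ?sb ?ea ?eb. Qed.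

Lemma evals_minus m a b x y :
  evals m a x -> evals m b y -> evals m (Minus a b) (x - y)%R.
Proof. by case=> sa ea [sb eb]; split; rewrite /= ?sa ?sb ?ea ?eb. Qed.

Lemma evals_dbl m a x : evals m a x -> evals m (Dbl a) (x + x)%R.
Proof. by case=> sa ea; split; rewrite /= ?sa ?ea. Qed.

Lemma evals_hlf m a x : evals m a x -> evals m (Hlf a) (x %/ 2)%Z.
Proof. by case=> sa ea; split; rewrite /= ?sa ?ea. Qed.

Lemma evals_at m a (n : nat) :
  evals m a n%:Z -> scratch <= n -> evals m (At a) (m n).
Proof. by case=> sa ea h; split; rewrite /= ?sa ?ea. Qed.

Lemma evals_sel m c a b (t : bool) x y :
  evals m c t%:Z -> evals m a x -> evals m b y ->
  evals m (Sel c a b) (if t then y else x).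
Proof.
by case=> sc ec [sa ea] [sb eb]; split; rewrite /= ec ?sc ?sa ?sb ?ea ?eb; case: t ec.
Qed.

Lemma evals_eq m a x y : evals m a x -> x = y -> evals m a y.
Proof. by move=> h <-. Qed.

Definition wp (b : block) (st : state) (Q : state -> Prop) : Prop :=
  block_safe b st /\ Q (block_exec b st).

Lemma wp_nil st (Q : state -> Prop) : Q st -> wp [::] st Q.
Proof. by []. Qed.

Lemma wp_asg a v b m i o (n : nat) z Q :
  evals m a n%:Z -> evals m v z -> scratch <= n ->
  width a <= scratch -> width v < scratch ->
  wp b (upd m n z, i, o) Q -> wp (Asg a v :: b) (m, i, o) Q.
Proof.
case=> sa ea [sv ev] hn wa wv [sb hQ]; split; rewrite /= ?sa ?ea ?sv ?ev ?wa ?wv //.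
by rewrite lez_nat hn.
Qed.

Lemma wp_inp a b m i o (n : nat) z Q :
  evals m a n%:Z -> scratch <= n -> width a <= scratch ->
  wp b (upd m n z, i, o) Q -> wp (Inp a :: b) (m, z :: i, o) Q.
Proof.
case=> sa ea hn wa [sb hQ]; split; rewrite /= ?sa ?ea ?wa //.
by rewrite lez_nat hn.
Qed.

Lemma wp_outp v b m i o z Q :
  evals m v z -> width v <= scratch ->
  wp b (m, i, rcons o z) Q -> wp (Outp v :: b) (m, i, o) Q.
Proof. by case=> sv ev wv [sb hQ]; split; rewrite /= ?sv ?ev ?wv. Qed.

Lemma wp_cat b1 b2 st Q :
  wp b1 st (fun st' => wp b2 st' Q) -> wp (b1 ++ b2) st Q.
Proof.
rewrite /wp => -[s1 [s2 hQ]]; split; last by rewrite /block_exec foldl_cat.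
elim: b1 st s1 s2 {hQ} => [|s b1 IH] st //= /andP [-> s1] s2.
exact: IH.
Qed.

Lemma wp_weaken b st (Q Q' : state -> Prop) :
  (forall st, Q st -> Q' st) -> wp b st Q -> wp b st Q'.
Proof. by move=> h [s q]; split=> //; apply: h. Qed.

Lemma block_run b st (Q : state -> Prop) : wp b st Q ->
  exists2 st', item_run (Block b) st (size (block_code b)) st' & Q st'.
Proof. by case=> s q; exists (block_exec b st). Qed.

(** The number [N] of iterations is fixed in advance by the caller, which makes the running time
    exact. *)
Lemma while_run r b (I : nat -> state -> Prop) N st :
  scratch <= r -> I 0 st ->
  (forall j st, j < N -> I j st -> (0 < mem st r)%R /\ wp b st (I j.+1)) ->
  (forall st, I N st -> (mem st r <= 0)%R) ->
  exists2 st', item_run (While r b) st (3 + N * (size (block_code b)).+1) st'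
             & I N st'.
Proof.
move=> hr I0 step stop.
have inv j : j <= N -> I j (iter j (block_exec b) st).
  elim: j => [//|j IH] hj; have [_ [_ h]] := step j _ hj (IH (ltnW hj)).
  by rewrite iterS.
exists (iter N (block_exec b) st); last exact: inv.
exists N; split=> //; last by apply: stop; apply: inv.
by move=> j hj; have [h0 [hs _]] := step j _ hj (inv j (ltnW hj)).
Qed.

End Specifications.

(** * The lattices and their encodings *)

Section Embedding.
Local Open Scope ring_scope.

(* The vertices [i + j = const] of the square lattice alternate between two
   consecutive rows of triangles. *)
Definition strip_point (k : grid_kind) : lattice_point k -> int * int * bool :=
  match k with
  | Square => fun p =>
      (((p.1 - p.2) %/ 2)%Z, ((p.1 + p.2) %/ 2)%Z,
       p.1 + p.2 != 2 * ((p.1 + p.2) %/ 2)%Z)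
  | Hexagonal => id
  end.

Lemma strip_point_inj k : injective (@strip_point k).
Proof.
case: k => [[i j] [i' j'] /= [e1 e2 e3]|//].
by have [-> ->] : i = i' /\ j = j' by lia.
Qed.

Lemma strip_point_adj k (p q : lattice_point k) :
  lattice_adj p q -> strip_adj (strip_point p) (strip_point q).
Proof.
move=> h; suff : exists2 s, (s < 4)%N & strip_point q = next (strip_point p) s.
  by case=> s hs e; apply/existsP; exists (Ordinal hs); apply/eqP.
case: k p q h => /=.
  case=> i j [i' j']; rewrite /square_adj /= => /eqP h.
  have : (i' = i + 1 /\ j' = j) \/ (i' = i - 1 /\ j' = j) \/
         (i' = i /\ j' = j + 1) \/ (i' = i /\ j' = j - 1).
    have : -1 <= i - i' <= 1 by nia.
    have : -1 <= j - j' <= 1 by nia.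
    nia.
  have [x xE] : exists x, x = ((i - j) %/ 2)%Z by eexists.
  have [y yE] : exists y, y = ((i + j) %/ 2)%Z by eexists.
  rewrite -xE -yE.
  (* The parity of [i + j] decides between upward and downward, and with it which slot each of the
     four lattice steps takes. *)
  have [ev|od] : i + j = 2 * y \/ i + j = 2 * y + 1 by lia.
    have -> : (i + j != 2 * y) = false by lia.
    move=> [[-> ->]|[[-> ->]|[[-> ->]|[-> ->]]]];
      [exists 0%N | exists 3%N | exists 1%N | exists 2%N] => //=;
      congr (_, _, _); lia.
  have -> : (i + j != 2 * y) = true by lia.
  move=> [[-> ->]|[[-> ->]|[[-> ->]|[-> ->]]]];
    [exists 3%N | exists 0%N | exists 2%N | exists 1%N] => //=;
    congr (_, _, _); lia.
(* The three [hex_offsets] correspond to the slots 0, 1 and 2; slot 3 never occurs. *)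
case=> [[i j] s] [[i' j'] s']; rewrite /hex_adj /hex_offsets.
case: s s' => -[] //; rewrite !inE -!pair_eqE /pair_eq /= => h.
  have [[h1 h2]|[[h1 h2]|[h1 h2]]] : (i = i' /\ j = j') \/ (i = i' - 1 /\ j = j') \/
     (i = i' /\ j = j' - 1) by lia.
  - by exists 0%N; rewrite //= h1 h2 !addr0.
  - by exists 1%N; rewrite //= h1 h2 addr0 subrK.
  - by exists 2%N; rewrite //= h1 h2 addr0 subrK.
have [[h1 h2]|[[h1 h2]|[h1 h2]]] : (i = i' /\ j = j') \/ (i' = i - 1 /\ j = j') \/
     (i = i' /\ j' = j - 1) by lia.
- by exists 0%N; rewrite //= h1 h2 !subr0.
- by exists 1%N; rewrite //= h1 h2 subr0.
- by exists 2%N; rewrite //= h1 h2 subr0.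
Qed.

End Embedding.


(* The record of vertex [v] has index [v + 1]; the record [0] stands for a
   missing neighbour.  Fields 0-2 hold the position, the fields [3 + s] and
   [7 + s] tell whether there is a neighbour in slot [s] and where its record
   starts.  The fields 11-15 of the record [0] serve as variables. *)
Definition cell (v f : nat) : nat := scratch + 16 * v + f.

(** A pointer is the offset [16 * v] without the base address, so a zero cell points to the record
    of the missing neighbour. *)
Definition adr (f : nat) (p : expr) : expr := Plus (Lit (Posz (scratch + f))) p.
Definition fld (f : nat) (p : expr) : expr := At (adr f p).
Definition var (f : nat) : expr := fld f (Lit 0%R).

Lemma evals_adr m p f (v : nat) :
  evals m p (Posz (16 * v)) -> evals m (adr f p) (Posz (cell v f)).
Proof.
by move=> h; apply: evals_eq (evals_plus (evals_lit _ _) h) _; rewrite /cell; lia.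
Qed.

Lemma evals_fld m p f (v : nat) :
  evals m p (Posz (16 * v)) -> evals m (fld f p) (m (cell v f)).
Proof. by move=> h; apply: evals_at (evals_adr f h) _; rewrite /cell; lia. Qed.

Lemma evals_adr_var m f : evals m (adr f (Lit 0%R)) (Posz (cell 0 f)).
Proof. exact: evals_adr. Qed.

Lemma evals_var m f : evals m (var f) (m (cell 0 f)).
Proof. exact: evals_fld. Qed.

Lemma updE (m : memory) a z : upd m a z a = z.
Proof. by rewrite /upd eqxx. Qed.

Lemma updN (m : memory) a b z : b != a -> upd m a z b = m b.
Proof. by rewrite /upd => /negbTE ->. Qed.

(** [vN] and [vM] count the vertices to output and the edges to read. [vC] counts the points to read
    and later holds the first endpoint; [vP] is the current record and later the second endpoint;
    [vQ] is temporary. *)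
Definition vN := 11.
Definition vM := 12.
Definition vC := 13.
Definition vP := 14.
Definition vQ := 15.

Definition fields (m : memory) (v : nat) (p : int * int * bool) : Prop :=
  [/\ m (cell v 0) = p.1.1, m (cell v 1) = p.1.2 & m (cell v 2) = Posz p.2].

(** In the square case the row waits in [vQ], since the fields 0 and 1 must keep the original
    coordinates until the parity and the column are computed. *)
Definition read_point (k : grid_kind) : block :=
  let P := var vP in
  match k with
  | Square =>
      [:: Inp (adr 0 P); Inp (adr 1 P);
          Asg (adr vQ (Lit 0%R)) (Hlf (Plus (fld 0 P) (fld 1 P)));
          Asg (adr 2 P) (Minus (Plus (fld 0 P) (fld 1 P)) (Dbl (var vQ)));
          Asg (adr 0 P) (Hlf (Minus (fld 0 P) (fld 1 P)));
          Asg (adr 1 P) (var vQ)]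
  | Hexagonal => [:: Inp (adr 0 P); Inp (adr 1 P); Inp (adr 2 P)]
  end.

Ltac unfold_addresses := rewrite /cell /scratch /vN /vM /vC /vP /vQ.

Ltac simpl_mem :=
  repeat first
    [ rewrite updE | rewrite updN; last by (unfold_addresses; lia) ].

Lemma evals_pointer m f v : m (cell 0 f) = Posz (16 * v) ->
  evals m (var f) (Posz (16 * v)).
Proof. exact: evals_eq (evals_var _ _). Qed.

Lemma read_point_correct k m v (p : lattice_point k) i o :
  m (cell 0 vP) = Posz (16 * v.+1) ->
  wp (read_point k) (m, encode_point p ++ i, o) (fun st => exists m',
    [/\ st = (m', i, o), fields m' v.+1 (strip_point p)
      & forall a, a != cell 0 vQ -> (a < cell v.+1 0) || (cell v.+1 3 <= a) ->
          m' a = m a]).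
Proof.
have adrP m' f : m' (cell 0 vP) = Posz (16 * v.+1) ->
    evals m' (adr f (var vP)) (Posz (cell v.+1 f)).
  by move=> h; apply/evals_adr/evals_pointer.
have fldP m' f : m' (cell 0 vP) = Posz (16 * v.+1) ->
    evals m' (fld f (var vP)) (m' (cell v.+1 f)).
  by move=> h; apply/evals_fld/evals_pointer.
case: k p => [[x y]|[[x y] s]] /= mP.
- apply: wp_inp (adrP _ _ _) _ _ _; simpl_mem => //.
  apply: wp_inp (adrP _ _ _) _ _ _; simpl_mem => //.
  apply: wp_asg (evals_adr_var _ vQ) (evals_hlf (evals_plus (fldP _ _ _)
    (fldP _ _ _))) _ _ _ _; simpl_mem => //.
  apply: wp_asg (adrP _ _ _) (evals_minus (evals_plus (fldP _ _ _) (fldP _ _ _))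
    (evals_dbl (evals_var _ _))) _ _ _ _; simpl_mem => //.
  apply: wp_asg (adrP _ _ _) (evals_hlf (evals_minus (fldP _ _ _) (fldP _ _ _)))
    _ _ _ _; simpl_mem => //.
  apply: wp_asg (adrP _ _ _) (evals_var _ _) _ _ _ _; simpl_mem => //.
  apply: wp_nil; eexists; split; first reflexivity.
  + by split; simpl_mem => //=; lia.
  + by move=> a h1 h2; move: h1 h2; unfold_addresses => h1 h2; rewrite !updN //; lia.
- do 3 (apply: wp_inp (adrP _ _ _) _ _ _; simpl_mem => //).
  apply: wp_nil; eexists; split; first reflexivity.
  + by split; simpl_mem.
  + by move=> a h1 h2; move: h1 h2; unfold_addresses => h1 h2; rewrite !updN //; lia.
Qed.

(** * The drawing program *)

Section Output.

Definition flag (s : nat) (p : expr) : expr := fld (3 + s) p.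
Definition link (s : nat) (p : expr) : expr := fld (7 + s) p.

Definition one_minus (a : expr) : expr := Minus (Lit 1%R) a.
(** On bits, [a - b + 1] reaches 2 only for [a = 1] and [b = 0], so floor halving acts as a
    conjunction; [nor] works the same way. *)
Definition and_not (a b : expr) : expr := Hlf (Plus (Minus a b) (Lit 1%R)).
Definition nor (a b : expr) : expr := Hlf (Minus (Minus (Lit 2%R) a) b).
Definition quadruple (a : expr) : expr := Dbl (Dbl a).

Definition shift_expr (p q : expr) : expr :=
  Minus (and_not (flag 3 p) (flag 2 p)) (and_not (flag 2 q) (flag 3 q)).

Section Expressions.
Let P := var vP.
Let col := Dbl (quadruple (fld 0 P)).
Let row := quadruple (fld 1 P).
Let par := fld 2 P.
Let lift := nor (flag 2 P) (flag 3 P).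
Let offset (z : int) (a : expr) := Plus (Plus col (Lit z)) a.

Definition apex_x : expr :=
  Sel par (offset 4%R (quadruple (shift_expr (link 0 P) (link 1 P))))
    (Plus col (Lit 8%R)).

Definition base_left : expr :=
  Sel par (Plus col (one_minus (flag 1 P)))
    (offset 4%R (quadruple (shift_expr P (link 1 (link 0 P))))).

Definition base_right : expr :=
  Sel par (Minus (Plus col (Lit 8%R)) (one_minus (flag 0 P)))
    (offset 12%R (quadruple (shift_expr (link 0 (link 1 P)) P))).

Definition apex_y : expr := Sel par (Plus row (Lit 4%R)) row.

Definition base_y : expr :=
  Sel par (Plus row lift) (Minus (Plus row (Lit 4%R)) lift).

Definition base_corner (b : expr) : expr :=
  Plus (quadruple b) (Sel lift (Lit 0%R) (Minus apex_x b)).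

Definition output_triangle : block :=
  [seq Outp a | a <-
    [:: base_corner base_left; Lit 1%R; base_y; Lit 1%R;
        base_corner base_right; Lit 1%R; base_y; Lit 1%R;
        quadruple apex_x; Lit 1%R; apex_y; Lit 1%R]].
End Expressions.

Variables (n : nat) (e : rel 'I_n) (pos : 'I_n -> int * int * bool).

Definition index (o : option 'I_n) : nat := if o is Some x then x.+1 else 0.

(** The case [o = None] makes record 0 link only to itself with all flags zero, so chains of links
    can be followed without tests. *)
Definition slots (m : memory) : Prop := forall o s, s < 4 ->
  let o' := obind (fun x => nbr e pos x s) o in
  m (cell (index o) (3 + s)) = Posz o' /\
  m (cell (index o) (7 + s)) = Posz (16 * index o').

Variable m : memory.
Hypothesis slots_m : slots m.

Lemma evals_flag p o s : s < 4 -> evals m p (Posz (16 * index o)) ->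
  evals m (flag s p) (Posz (obind (fun x => nbr e pos x s) o)).
Proof. by move=> hs /(evals_fld (3 + s)) /evals_eq; apply; case: (slots_m o hs). Qed.

Lemma evals_link p o s : s < 4 -> evals m p (Posz (16 * index o)) ->
  evals m (link s p) (Posz (16 * index (obind (fun x => nbr e pos x s) o))).
Proof. by move=> hs /(evals_fld (7 + s)) /evals_eq; apply; case: (slots_m o hs). Qed.

Lemma evals_one_minus a (b : bool) :
  evals m a (Posz b) -> evals m (one_minus a) (Posz (~~ b)).
Proof. by move=> h; apply: evals_eq (evals_minus (evals_lit _ _) h) _; case: b h. Qed.

Lemma evals_and_not a b (x y : bool) : evals m a (Posz x) -> evals m b (Posz y) ->
  evals m (and_not a b) (Posz (x && ~~ y)).
Proof.
move=> hx hy; apply: evals_eq (evals_hlf (evals_plus (evals_minus hx hy)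
  (evals_lit _ _))) _.
by case: x {hx}; case: y {hy}.
Qed.

Lemma evals_nor a b (x y : bool) : evals m a (Posz x) -> evals m b (Posz y) ->
  evals m (nor a b) (Posz (~~ (x || y))).
Proof.
move=> hx hy; apply: evals_eq (evals_hlf (evals_minus (evals_minus
  (evals_lit _ _) hx) hy)) _.
by case: x {hx}; case: y {hy}.
Qed.

Lemma evals_quadruple a z : evals m a z -> evals m (quadruple a) (4%:Z * z)%R.
Proof. by move=> h; apply: evals_eq (evals_dbl (evals_dbl h)) _; ring. Qed.

Lemma evals_shift p q o o' : evals m p (Posz (16 * index o)) ->
  evals m q (Posz (16 * index o')) ->
  evals m (shift_expr p q) (shift e pos o o').
Proof.
move=> hp hq; apply: evals_eq (evals_minus (evals_and_not (evals_flag _ hp)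
  (evals_flag _ hp)) (evals_and_not (evals_flag _ hq) (evals_flag _ hq))) _ => //.
by rewrite /shift; case: o {hp} => [x|] /=; case: o' {hq} => [y|] //=; rewrite andbC.
Qed.

Variable x : 'I_n.
Hypothesis fields_m : fields m x.+1 (pos x).
Hypothesis pointer_m : m (cell 0 vP) = Posz (16 * x.+1).

Definition fraction_triangle (t : triangle int) : triangle fraction :=
  map_triangle (fun z => (z, 1%R)) t.

Lemma output_triangle_correct i o :
  wp output_triangle (m, i, o) (fun st =>
    st = (m, i, o ++ encode_triangle (fraction_triangle (layout e pos x)))).
Proof.
have [f0 f1 f2] := fields_m.
have hP : evals m (var vP) (Posz (16 * index (Some x))) by apply: evals_pointer.
have hpar := evals_eq (evals_fld 2 hP) f2.
have hk := evals_eq (evals_fld 0 hP) f0.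
have hy := evals_eq (evals_fld 1 hP) f1.
have hrow := evals_quadruple hy.
have hcol : evals m (Dbl (quadruple (fld 0 (var vP)))) (8%:Z * (pos x).1.1)%R.
  by apply: evals_eq (evals_dbl (evals_quadruple hk)) _; ring.
have flagP s (hs : s < 4) := evals_flag hs hP.
have hlift := evals_nor (flagP 2 isT) (flagP 3 isT).
have offsetP z a w : evals m a w -> evals m (Plus (Plus (Dbl (quadruple (fld 0 (var vP)))) (Lit z)) a) _ :=
  fun h => evals_plus (evals_plus hcol (evals_lit m z)) h.
have linkP s (hs : s < 4) := evals_link hs hP.
have ha : evals m apex_x _ := evals_sel hpar (offsetP 4%R _ _ (evals_quadruple
  (evals_shift (linkP 0 isT) (linkP 1 isT)))) (evals_plus hcol (evals_lit m 8%R)).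
have hb1 : evals m base_left _ := evals_sel hpar (evals_plus hcol (evals_one_minus
  (flagP 1 isT))) (offsetP 4%R _ _ (evals_quadruple (evals_shift hP
    (evals_link (s := 1) isT (linkP 0 isT))))).
have hb2 : evals m base_right _ := evals_sel hpar (evals_minus (evals_plus hcol
  (evals_lit m 8%R)) (evals_one_minus (flagP 0 isT))) (offsetP 12%R _ _
  (evals_quadruple (evals_shift (evals_link (s := 0) isT (linkP 1 isT)) hP))).
have hya : evals m apex_y _ := evals_sel hpar (evals_plus hrow (evals_lit m 4%R)) hrow.
have hyb : evals m base_y _ := evals_sel hpar (evals_plus hrow hlift)
  (evals_minus (evals_plus hrow (evals_lit m 4%R)) hlift).
have cornerP b z : evals m b z -> evals m (base_corner b) _ := fun h =>
  evals_plus (evals_quadruple h) (evals_sel hlift (evals_lit m 0%R) (evals_minus ha h)).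
rewrite /output_triangle /=.
apply: wp_outp (cornerP _ _ hb1) _ _; first by vm_compute.
apply: wp_outp (evals_lit _ _) _ _ => //.
apply: (wp_outp hyb); first by vm_compute.
apply: wp_outp (evals_lit _ _) _ _ => //.
apply: wp_outp (cornerP _ _ hb2) _ _; first by vm_compute.
apply: wp_outp (evals_lit _ _) _ _ => //.
apply: (wp_outp hyb); first by vm_compute.
apply: wp_outp (evals_lit _ _) _ _ => //.
apply: wp_outp (evals_quadruple ha) _ _; first by vm_compute.
apply: wp_outp (evals_lit _ _) _ _ => //.
apply: (wp_outp hya); first by vm_compute.
apply: wp_outp (evals_lit _ _) _ _ => //.
apply: wp_nil; congr (_, _, _); rewrite -!cats1 -!catA /=; congr (_ ++ _).
by rewrite /layout; case: (pos x) => [[k y] []].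
Qed.

End Output.

(** * Recording an edge in the records of its endpoints *)

Section Edges.

Lemma cell_eq v f v' f' : f < 16 -> f' < 16 ->
  (cell v f == cell v' f') = (v == v') && (f == f').
Proof. by rewrite /cell; lia. Qed.

Variables (n : nat) (pos : 'I_n -> int * int * bool).
Hypothesis pos_inj : injective pos.

Definition edge_rel (es : seq ('I_n * 'I_n)) : rel 'I_n :=
  fun x y => ((x, y) \in es) || ((y, x) \in es).

(** As a slot is its own reverse, a new edge fills the same slot at both endpoints; [next_slot]
    shows that it fills no other. *)
Lemma nbr_rcons es u v s x s' : s < 4 -> s' < 4 -> pos v = next (pos u) s ->
  nbr (edge_rel (rcons es (u, v))) pos x s' =
    if (x == u) && (s' == s) then Some v
    else if (x == v) && (s' == s) then Some u
    else nbr (edge_rel es) pos x s'.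
Proof.
move=> hs hs' pv; have pu : pos u = next (pos v) s by rewrite pv nextK.
case: ifP => [/andP [/eqP -> /eqP ->]|h1].
  by apply/(nbrP _ pos_inj); rewrite /edge_rel !mem_rcons !inE eqxx.
case: ifP => [/andP [/eqP -> /eqP ->]|h2].
  by apply/(nbrP _ pos_inj); rewrite /edge_rel !mem_rcons !inE eqxx orbT.
apply: eq_pick => y /=; rewrite /edge_rel !mem_rcons !inE.
case: (eqVneq (pos y) (next (pos x) s')) => py; rewrite ?andbF // !andbT.
have -> : ((x, y) == (u, v)) = false.
  apply: contraFF h1 => /eqP [ex ey]; subst x y; rewrite eqxx /=.
  by apply/eqP; apply: (@next_slot (pos u)) => //; rewrite -py.
have -> //: ((y, x) == (u, v)) = false.
apply: contraFF h2 => /eqP [ey ex]; subst x y; rewrite eqxx /=.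
by apply/eqP; apply: (@next_slot (pos v)) => //; rewrite -py.
Qed.

Definition parity (a : expr) : expr := Minus a (Dbl (Hlf a)).
Definition record_pointer (a : expr) : expr :=
  Dbl (Dbl (Dbl (Dbl (Plus a (Lit 1%R))))).
Definition decrement (f : nat) : stmt :=
  Asg (adr f (Lit 0%R)) (Minus (var f) (Lit 1%R)).

Definition record_edge : block :=
  let U := var vC in
  let V := var vP in
  let Q := var vQ in
  [:: Inp (adr vC (Lit 0%R)); Inp (adr vP (Lit 0%R));
      Asg (adr vC (Lit 0%R)) (record_pointer U);
      Asg (adr vP (Lit 0%R)) (record_pointer V);
      Asg (adr vQ (Lit 0%R))
        (Plus (parity (Minus (fld 0 U) (fld 0 V)))
              (Dbl (parity (Minus (fld 1 U) (fld 1 V)))));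
      Asg (adr 3 (Plus U Q)) (Lit 1%R); Asg (adr 3 (Plus V Q)) (Lit 1%R);
      Asg (adr 7 (Plus U Q)) V; Asg (adr 7 (Plus V Q)) U;
      decrement vM].

Lemma evals_record_pointer m a (v : nat) : evals m a (Posz v) ->
  evals m (record_pointer a) (Posz (16 * v.+1)).
Proof.
move=> h; apply: evals_eq (evals_dbl (evals_dbl (evals_dbl (evals_dbl (evals_plus h
  (evals_lit _ _)))))) _; lia.
Qed.

Lemma evals_parity m a z : evals m a z ->
  evals m (parity a) (z - ((z %/ 2)%Z + (z %/ 2)%Z))%R.
Proof. by move=> h; apply: evals_minus h (evals_dbl (evals_hlf h)). Qed.

Lemma evals_slot m p q f v s : evals m p (Posz (16 * v)) -> evals m q (Posz s) ->
  evals m (adr f (Plus p q)) (Posz (cell v (f + s))).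
Proof.
move=> hp hq; apply: evals_eq (evals_plus (evals_lit _ _) (evals_plus hp hq)) _.
by rewrite /cell; lia.
Qed.

Lemma evals_var_eq m f z : m (cell 0 f) = z -> evals m (var f) z.
Proof. exact: evals_eq (evals_var _ _). Qed.

(** Up to sign, [next] changes the column by the low binary digit of [s] and the row by the high
    one, so the parities of the differences recover [s]. *)
Lemma slot_value p q s : s < 4 -> q = next p s ->
  let d z : int := (z - ((z %/ 2)%Z + (z %/ 2)%Z))%R in
  (d (p.1.1 - q.1.1) + (d (p.1.2 - q.1.2) + d (p.1.2 - q.1.2)))%R = Posz s.
Proof.
move=> hs ->; case: p => [[k y] b] /=.
by case: b; case: s hs => [|[|[|[|s]]]] //= _; lia.
Qed.

Lemma record_edge_correct m es u v s i o :
  s < 4 -> pos v = next (pos u) s ->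
  (forall x : 'I_n, fields m x.+1 (pos x)) -> slots (edge_rel es) pos m ->
  wp record_edge (m, [:: Posz (val u), Posz (val v) & i], o) (fun st => exists m',
    [/\ st = (m', i, o), forall x : 'I_n, fields m' x.+1 (pos x),
        slots (edge_rel (rcons es (u, v))) pos m', m' (cell 0 vN) = m (cell 0 vN)
      & m' (cell 0 vM) = (m (cell 0 vM) - 1)%R]).
Proof.
move=> hs pv hf hsl.
apply: wp_inp (evals_adr_var _ _) _ _ _ => //.
apply: wp_inp (evals_adr_var _ _) _ _ _ => //.
apply: wp_asg (evals_adr_var _ _) (evals_record_pointer (v := u) (evals_var_eq _))
  _ _ _ _; simpl_mem => //.
apply: wp_asg (evals_adr_var _ _) (evals_record_pointer (v := v) (evals_var_eq _))
  _ _ _ _; simpl_mem => //.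
have [fu0 fu1 _] := hf u; have [fv0 fv1 _] := hf v.
apply: wp_asg (evals_adr_var _ _) (evals_eq (y := Posz s) (evals_plus
  (evals_parity (evals_minus (evals_fld 0 (evals_pointer (v := u.+1) _))
     (evals_fld 0 (evals_pointer (v := v.+1) _))))
  (evals_dbl (evals_parity (evals_minus (evals_fld 1 (evals_pointer (v := u.+1) _))
     (evals_fld 1 (evals_pointer (v := v.+1) _)))))) _)
  _ _ _ _; simpl_mem => //.
  by rewrite fu0 fu1 fv0 fv1; apply: slot_value.
set m1 := upd _ (cell 0 vQ) _.
have [e1 e2 e3 e4 e5] : [/\ m1 (cell 0 vC) = Posz (16 * u.+1),
    m1 (cell 0 vP) = Posz (16 * v.+1), m1 (cell 0 vQ) = Posz s,
    m1 (cell 0 vN) = m (cell 0 vN) & m1 (cell 0 vM) = m (cell 0 vM)].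
  by rewrite /m1; split; simpl_mem.
have m1E w f : (0 < w) || (f < 11) -> f < 16 -> m1 (cell w f) = m (cell w f).
  by move=> hw hf'; rewrite /m1; simpl_mem.
clearbody m1.
apply: wp_asg (evals_slot 3 (evals_pointer (v := u.+1) _) (evals_var_eq (z := Posz s) _))
  (evals_lit _ _) _ _ _ _; simpl_mem => //.
apply: wp_asg (evals_slot 3 (evals_pointer (v := v.+1) _) (evals_var_eq (z := Posz s) _))
  (evals_lit _ _) _ _ _ _; simpl_mem => //.
apply: wp_asg (evals_slot 7 (evals_pointer (v := u.+1) _) (evals_var_eq (z := Posz s) _))
  (evals_var_eq (z := Posz (16 * v.+1)) _) _ _ _ _; simpl_mem => //.
apply: wp_asg (evals_slot 7 (evals_pointer (v := v.+1) _) (evals_var_eq (z := Posz s) _))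
  (evals_var_eq (z := Posz (16 * u.+1)) _) _ _ _ _; simpl_mem => //.
apply: wp_asg (evals_adr_var _ _) (evals_minus (evals_var _ _) (evals_lit _ _))
  _ _ _ _; simpl_mem => //.
rewrite e5; apply: wp_nil; eexists; split; first reflexivity.
- move=> x; have [h0 h1 h2] := hf x.
  by split; simpl_mem; rewrite m1E.
(* [next] flips the orientation bit, so an edge cannot be a loop. *)
- have uv : (u == v) = false.
    by apply/eqP => uv; move: pv; rewrite uv; case: (pos v) => [[? ?] []].
  move=> [x|] s' hs' /=; last first.
    have [h1 h2] := hsl None s' hs'.
    by split; simpl_mem; (rewrite m1E; [by [] | lia | lia]).
  have [h1 h2] := hsl (Some x) s' hs'; rewrite /= in h1 h2.
  rewrite (nbr_rcons _ _ hs hs' pv) /upd !cell_eq; try by (unfold_addresses; lia).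
  rewrite !m1E ?h1 ?h2; try lia.
  rewrite ?eqSS -!val_eqE /=.
  (* Slots are below 4, so the flag fields 3 to 6 and the link fields 7 to 10 do not overlap. *)
  have s1 : (s' == s.+4) = false by lia.
  have s2 : (s'.+4 == s) = false by lia.
  rewrite s1 s2 !andbF; move: uv; rewrite -val_eqE /= => uv.
  case: (nat_of_ord x =P u) => [xu|_]; case: (nat_of_ord x =P v) => [xv|_] /=;
    case: (s' == s) => //=.
  by rewrite -xu -xv eqxx in uv.
- by simpl_mem.
- by simpl_mem.
Qed.

End Edges.

(** * The complete program, its loop invariants and its running time *)

Section Program.

Definition advance (f : nat) : block :=
  [:: Asg (adr vP (Lit 0%R)) (Plus (var vP) (Lit 16%R)); decrement f].

Definition first_record : stmt := Asg (adr vP (Lit 0%R)) (Lit 16%R).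

Definition drawing_program (k : grid_kind) : seq item :=
  [:: Block [:: Inp (adr vN (Lit 0%R)); Inp (adr vM (Lit 0%R));
         Asg (adr vC (Lit 0%R)) (var vN); first_record];
      While (cell 0 vC) (read_point k ++ advance vC);
      While (cell 0 vM) record_edge;
      Block [:: first_record];
      While (cell 0 vN) (output_triangle ++ advance vN)].

Lemma advance_correct m i o f v (c : int) : f < 16 -> f != vP ->
  m (cell 0 vP) = Posz (16 * v) -> m (cell 0 f) = c ->
  wp (advance f) (m, i, o) (fun st => exists m', [/\ st = (m', i, o),
    m' (cell 0 vP) = Posz (16 * v.+1), m' (cell 0 f) = (c - 1)%R
    & forall a, a != cell 0 vP -> a != cell 0 f -> m' a = m a]).
Proof.
move=> hf hfP hP hc.
apply: wp_asg (evals_adr_var _ _) (evals_plus (evals_var_eq hP) (evals_lit _ 16%R))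
  _ _ _ _ => //.
apply: wp_asg (evals_adr_var _ _) (evals_minus (evals_var _ _) (evals_lit _ 1%R))
  _ _ _ _ => //.
apply: wp_nil; eexists; split; first reflexivity.
- by rewrite updN ?updE; [lia | move: hfP; unfold_addresses; lia].
- by rewrite updE updN ?hc //; move: hfP; unfold_addresses; lia.
- by move=> a h1 h2; rewrite !updN.
Qed.

Variables (k : grid_kind) (n : nat) (e : rel 'I_n).
Variables (place : 'I_n -> lattice_point k) (es : seq ('I_n * 'I_n)).
Hypotheses (place_map : subgraph_map e (@lattice_adj k) place).
Hypothesis es_e : edge_list e es.

Let pos x := strip_point (place x).

Definition points_from (j : nat) : seq int :=
  flatten [seq encode_point (place x) | x <- drop j (enum 'I_n)].

Definition edges_from (j : nat) : seq int :=
  flatten [seq [:: Posz (val u.1); Posz (val u.2)] | u <- drop j es].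

Definition drawing (x : 'I_n) : triangle fraction :=
  fraction_triangle (layout e pos x).

Definition output_upto (j : nat) : seq int :=
  flatten [seq encode_triangle (drawing x) | x <- take j (enum 'I_n)].

(** The last clause keeps the flags and links of all records at their initial zero, ready for the
    edge phase. *)
Definition read_invariant (j : nat) (st : state) : Prop :=
  exists m, [/\ st = (m, points_from j ++ edges_from 0, [::]),
    m (cell 0 vN) = Posz n /\ m (cell 0 vM) = Posz (size es),
    m (cell 0 vC) = (Posz n - Posz j)%R /\ m (cell 0 vP) = Posz (16 * j.+1),
    forall x : 'I_n, x < j -> fields m x.+1 (pos x)
  & forall v f, 3 <= f <= 10 -> m (cell v f) = 0%R].

Definition edge_invariant (j : nat) (st : state) : Prop :=
  exists m, [/\ st = (m, edges_from j, [::]), m (cell 0 vN) = Posz n,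
    m (cell 0 vM) = (Posz (size es) - Posz j)%R,
    forall x : 'I_n, fields m x.+1 (pos x)
  & slots (edge_rel (take j es)) pos m].

Definition output_invariant (j : nat) (st : state) : Prop :=
  exists m, [/\ st = (m, [::], output_upto j),
    m (cell 0 vN) = (Posz n - Posz j)%R, m (cell 0 vP) = Posz (16 * j.+1),
    forall x : 'I_n, fields m x.+1 (pos x)
  & slots e pos m].

Lemma pos_inj : injective pos.
Proof. by move=> x y /strip_point_inj /(proj1 place_map). Qed.

Lemma drop_enum j (hj : j < n) :
  drop j (enum 'I_n) = Ordinal hj :: drop j.+1 (enum 'I_n).
Proof.
rewrite (drop_nth (Ordinal hj)) ?size_enum_ord //; congr (_ :: _).
by apply: val_inj; rewrite /= nth_enum_ord.
Qed.

Lemma take_enum j (hj : j < n) :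
  take j.+1 (enum 'I_n) = rcons (take j (enum 'I_n)) (Ordinal hj).
Proof.
rewrite (take_nth (Ordinal hj)) ?size_enum_ord //; congr (rcons _ _).
by apply: val_inj; rewrite /= nth_enum_ord.
Qed.

Lemma initial_correct :
  wp [:: Inp (adr vN (Lit 0%R)); Inp (adr vM (Lit 0%R));
         Asg (adr vC (Lit 0%R)) (var vN); first_record]
     (fun=> 0%R, encode_graph place es, [::]) (read_invariant 0).
Proof.
rewrite /encode_graph /=.
apply: wp_inp (evals_adr_var _ _) _ _ _ => //.
apply: wp_inp (evals_adr_var _ _) _ _ _ => //.
apply: wp_asg (evals_adr_var _ _) (evals_var _ _) _ _ _ _ => //.
apply: wp_asg (evals_adr_var _ _) (evals_lit _ _) _ _ _ _ => //.
apply: wp_nil; eexists; split.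
- by rewrite /points_from /edges_from !drop0.
- by split; simpl_mem.
- by split; simpl_mem; rewrite // subr0.
- by [].
- by move=> v f hf; simpl_mem.
Qed.

Lemma read_step j st : j < n -> read_invariant j st ->
  (0 < mem st (cell 0 vC))%R /\
  wp (read_point k ++ advance vC) st (read_invariant j.+1).
Proof.
move=> hj [m [-> [hN hM] [hC hP] hf hz]]; split.
  by rewrite /mem /= hC; lia.
rewrite /points_from (drop_enum hj) /= -catA.
apply: wp_cat; apply: wp_weaken (read_point_correct (v := j) _ _ _ hP) => st1.
case=> m1 [-> hf1 h1].
have m1E f : 10 < f < 15 -> m1 (cell 0 f) = m (cell 0 f).
  by move=> hf'; apply: h1; move: hf'; unfold_addresses; lia.
apply: wp_weaken (advance_correct (f := vC) _ _ _ _ (etrans (m1E vP _) hP)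
  (etrans (m1E vC _) hC)) => // st2 [m2 [-> hP2 hC2 h2]].
have m2E v f : (v == 0) ==> (f != vC) && (f != vP) -> f < 16 ->
    m2 (cell v f) = m1 (cell v f).
  by move=> hv hf'; apply: h2; move: hv hf'; unfold_addresses; lia.
exists m2; split=> //.
- by rewrite !m2E // !m1E.
- by rewrite hC2; split=> //; lia.
- move=> x; rewrite ltnS leq_eqVlt => /orP [/eqP xj|xj].
    have -> : x = Ordinal hj by apply: val_inj.
    by case: hf1 => g0 g1 g2; split; rewrite m2E.
  case: (hf x xj) => g0 g1 g2.
  by split; rewrite m2E // h1 //; move: xj; unfold_addresses; lia.
- move=> v f hf'; rewrite m2E; [|by move: hf'; rewrite /vC /vP; lia|by lia].
  by rewrite h1 ?hz //; move: hf'; unfold_addresses; lia.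
Qed.

(** Zero flags and links are exactly the [slots] of the graph without edges. *)
Lemma read_done st : read_invariant n st -> edge_invariant 0 st.
Proof.
case=> m [-> [hN hM] [hC hP] hf hz]; exists m; split=> //.
- by rewrite /points_from drop_oversize ?size_enum_ord.
- by rewrite hM subr0.
- by move=> x; apply: hf.
- rewrite take0 => o s hs /=.
  have -> : obind (fun x => nbr (edge_rel [::]) pos x s) o = None.
    by case: o => [x|] //=; rewrite /nbr; case: pickP.
  by split; apply: hz; lia.
Qed.


Lemma edge_step j st : j < size es -> edge_invariant j st ->
  (0 < mem st (cell 0 vM))%R /\ wp record_edge st (edge_invariant j.+1).
Proof.
move=> hj [m [-> hN hM hf hs]]; split; first by rewrite /mem /= hM; lia.
have [u0 _] : exists u0, u0 \in es by case: (es) hj => // u0 *; exists u0; apply: mem_head.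
have [u [v uv]] : exists u v, nth u0 es j = (u, v).
  by case: (nth u0 es j) => u v; exists u, v.
have uv_es : (u, v) \in es by rewrite -uv mem_nth.
have [s hs4 pv] : exists2 s, s < 4 & pos v = next (pos u) s.
  have : strip_adj (pos u) (pos v).
    apply: strip_point_adj; apply: (proj2 place_map).
    by case: es_e => _ _ ->; rewrite uv_es.
  by case/existsP => s /eqP ->; exists s.
rewrite /edges_from (drop_nth u0) // uv /=.
apply: wp_weaken (record_edge_correct pos_inj _ _ hs4 pv hf hs) => st1.
case=> m1 [-> hf1 hs1 hN1 hM1]; exists m1; split=> //.
- by rewrite hN1.
- by rewrite hM1 hM; lia.
- by rewrite (take_nth u0) // uv.
Qed.

Lemma edge_done st : edge_invariant (size es) st ->
  wp [:: first_record] st (output_invariant 0).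
Proof.
case=> m [-> hN hM hf hs].
apply: wp_asg (evals_adr_var _ _) (evals_lit _ _) _ _ _ _ => //.
apply: wp_nil; eexists; split.
- by rewrite /edges_from drop_size /output_upto take0.
- by simpl_mem; rewrite hN subr0.
- by simpl_mem.
- by move=> x; case: (hf x) => g0 g1 g2; split; simpl_mem.
- move=> o s hs4; have [g0 g1] := hs o s hs4.
  have nE x : nbr (edge_rel (take (size es) es)) pos x s = nbr e pos x s.
    apply: eq_pick => y /=; rewrite take_size; case: es_e => _ _ ->.
    by rewrite /edge_rel.
  have oE : obind (fun x => nbr (edge_rel (take (size es) es)) pos x s) o =
    obind (fun x => nbr e pos x s) o by case: (o) => //= x; rewrite nE.
  by rewrite oE in g0 g1; split; simpl_mem.
Qed.

Lemma output_step j st : j < n -> output_invariant j st ->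
  (0 < mem st (cell 0 vN))%R /\
  wp (output_triangle ++ advance vN) st (output_invariant j.+1).
Proof.
move=> hj [m [-> hN hP hf hs]]; split; first by rewrite /mem /= hN; lia.
apply: wp_cat; apply: wp_weaken (output_triangle_correct hs (hf (Ordinal hj)) hP _ _).
move=> _ ->; apply: wp_weaken (advance_correct (f := vN) _ _ _ _ hP hN) => // st1.
case=> m1 [-> hP1 hN1 h1].
have m1E v f : (v == 0) ==> (f != vN) && (f != vP) -> f < 16 ->
    m1 (cell v f) = m (cell v f).
  by move=> hv hf'; apply: h1; move: hv hf'; unfold_addresses; lia.
exists m1; split=> //.
- by rewrite /output_upto (take_enum hj) map_rcons flatten_rcons.
- by rewrite hN1; lia.
- by move=> x; case: (hf x) => g0 g1 g2; split; rewrite m1E.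
- by move=> o s hs4; have [g0 g1] := hs o s hs4; split; rewrite m1E // /vN /vP; lia.
Qed.

Lemma output_done st : output_invariant n st ->
  st.2 = flatten [seq encode_triangle (drawing x) | x <- enum 'I_n].
Proof. by case=> m [-> _ _ _ _]; rewrite /= /output_upto take_oversize ?size_enum_ord. Qed.

Lemma time_bound (a b c d f N M : nat) :
  a + (3 + N * b + (3 + M * c + (d + (3 + N * f + 0)))) <=
  (a + b + c + d + f + 9) * (N + M + 1).
Proof. by nia. Qed.

(** The factor depends only on [k]. Its 14 dominates, for each of the three loops, three
    instructions of entry and final test and one closing jump per iteration. *)
Lemma drawing_program_correct : exists t,
  (t <= (\sum_(it <- drawing_program k)
          size (block_code (match it with Block b | While _ b => b end)) + 14) *
        (n + size es + 1)) /\
  runs_in (compile 0 (drawing_program k)) (encode_graph place es) t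
    (flatten [seq encode_triangle (drawing x) | x <- enum 'I_n]).
Proof.
have [st1 r1 i1] := block_run initial_correct.
have [//||st2 r2 i2] := while_run (r := cell 0 vC) _ i1 read_step.
  by move=> st [m [-> _ [hC _] _ _]]; rewrite /mem /= hC subrr.
have [//||st3 r3 i3] := while_run (r := cell 0 vM) _ (read_done i2) edge_step.
  by move=> st [m [-> _ hM _ _]]; rewrite /mem /= hM subrr.
have [st4 r4 i4] := block_run (edge_done i3).
have [//||st5 r5 i5] := while_run (r := cell 0 vN) _ i4 output_step.
  by move=> st [m [-> hN _ _ _]]; rewrite /mem /= hN subrr.
eexists; split; last first.
  rewrite -(output_done i5); apply: compile_correct.
  apply: Items_cons r1 _; apply: Items_cons r2 _; apply: Items_cons r3 _.
  by apply: Items_cons r4 _; apply: Items_cons r5 _; apply: Items_nil.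
rewrite !big_cons big_nil.
apply: leq_trans (time_bound _ _ _ _ _ _ _) _.
by rewrite leq_mul2r; apply/orP; right; lia.
Qed.

End Program.

Theorem theorem2 (R : realType) :
  (forall (k : grid_kind) (T : finType) (e : rel T),
     simple_graph e ->
     (exists (U : finType) (g : rel U), grid_graph k g /\ subgraph e g) ->
     exists t : T -> triangle R, touching_triangles e t)
  /\
  (forall k : grid_kind,
     exists (p : program) (c : nat),
       forall (n : nat) (e : rel 'I_n) (pos : 'I_n -> lattice_point k)
              (es : seq ('I_n * 'I_n)),
         simple_graph e ->
         subgraph_map e (@lattice_adj k) pos ->
         edge_list e es ->
         exists (t : nat) (output : seq int),
           [/\ (t <= c * (n + size es + 1))%N,
               runs_in p (encode_graph pos es) t output
             & encodes_representation R e output]).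
Proof.
have touching k (T : finType) (e : rel T) (f : T -> lattice_point k) :
    simple_graph e -> subgraph_map e (@lattice_adj k) f ->
    touching_triangles e
      (fun x => real_triangle R (layout e (fun y => strip_point (f y)) x)).
  case=> e_sym _ [f_inj f_adj]; apply: layout_touching => //.
    by move=> x y /strip_point_inj /f_inj.
  by move=> x y /f_adj /strip_point_adj.
split.
  move=> k T e e_simple [U [g [[_ [h [h_inj h_adj]]] [f [f_inj f_adj]]]]].
  eexists; apply: (touching k _ _ (h \o f)) => //; split.
    exact: inj_comp.
  by move=> x y /f_adj /h_adj.
(* The constant is left open before the graph is introduced and is later read off from the time
   bound, so it is uniform in the input. *)
move=> k; exists (compile 0 (drawing_program k)); eexists.
move=> n e pos es e_simple pos_map es_e.
have [t [ht run]] := drawing_program_correct pos_map es_e.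
exists t; eexists; split; [exact: ht | exact: run | ].
exists (drawing e pos); split=> //.
  by move=> x; rewrite /drawing; case: (layout _ _ _) => ? ? ? /=.
have -> : (fun x => map_triangle (@fraction_val R) (drawing e pos x)) =
    (fun x => real_triangle R (layout e (fun y => strip_point (pos y)) x)).
  apply: funext => x; rewrite /drawing; case: (layout _ _ _) => a b c /=.
  by rewrite /real_triangle /fraction_val /= !divr1.
exact: touching.
Qed.
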